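(* Let $\Sigma$ be an oriented Riemann surface and let $X:\Sigma\to\mathrm{Nil}_3$ be a conformal minimal immersion, with Gauss map $g:\Sigma\to\bar{\mathbb{C}}=\mathbb{C}\cup\{\infty\}$. Then, for any local conformal coordinate $z$ on $\Sigma$, the map $g$ satisfies $$(1-|g|^2)\,g_{z\bar z}+2\bar g\,g_z\,g_{\bar z}=0$$ at points where $g\neq\infty$; and in the neighbourhood of any point where $g=\infty$, the function $\frac1g$ satisfies the same equation, i.e. the equation obtained by replacing $g$ by $\frac1g$.
   Context: The Heisenberg group $\mathrm{Nil}_3$ is $\mathbb{R}^3$ with coordinates $(x_1,x_2,x_3)$ and the Riemannian metric $$dx_1^2+dx_2^2+\left(\tfrac12(x_2\,dx_1-x_1\,dx_2)+dx_3\right)^2 .$$ The canonical left-invariant orthonormal frame is $E_1=\frac{\partial}{\partial x_1}-\frac{x_2}{2}\frac{\partial}{\partial x_3}$, $E_2=\frac{\partial}{\partial x_2}+\frac{x_1}{2}\frac{\partial}{\partial x_3}$, $E_3=\frac{\partial}{\partial x_3}$, and $\mathrm{Nil}_3$ is oriented so that this frame is positive. Tangent vectors are identified with elements of the Lie algebra by left multiplication, i.e. with their coordinates in the frame $(E_1,E_2,E_3)$. For a conformal immersion $X:\Sigma\to\mathrm{Nil}_3$ of an oriented Riemann surface, with conformal coordinate $z=u+iv$, the unit normal $N$ is the normalization of $X_u\times X_v$, regarded as a map $N:\Sigma\to\mathbb{S}^2$ into the unit sphere of the Lie algebra. The Gauss map of $X$ is the map $g:\Sigma\to\bar{\mathbb{C}}$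 obtained by stereographic projection of $N$ from the southern pole, i.e. in the frame $(E_1,E_2,E_3)$ $$N=\frac{1}{1+|g|^2}\bigl(2\,\mathrm{Re}\,g,\;2\,\mathrm{Im}\,g,\;1-|g|^2\bigr).$$ Subscripts $z,\bar z$ denote the derivatives $\partial_z=\frac12(\partial_u-i\partial_v)$ and $\partial_{\bar z}=\frac12(\partial_u+i\partial_v)$. Everything is smooth. *)

(* Defs.v *)
From HB Require Import structures.
From mathcomp Require Import all_boot all_order all_algebra.
From mathcomp Require Import complex.
From mathcomp Require Import all_classical all_reals all_analysis.

Set Implicit Arguments.
Unset Strict Implicit.
Unset Printing Implicit Defensive.

Import Order.TTheory GRing.Theory Num.Theory.
Import numFieldNormedType.Exports.

Local Open Scope classical_set_scope.
Local Open Scope ring_scope.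
Local Open Scope complex_scope.

(* The topology of R[i] is that of its modulus; [derivable f z 1] for
   [f : R[i] -> R[i]] then means complex differentiability at [z]. *)
HB.instance Definition _ (R : realType) := NormedModule.copy R[i] (R[i]^o).

Definition line_u (R : realType) (V : Type) (f : R[i] -> V) (z : R[i]) : R -> V :=
  fun t => f (t +i* complex.Im z).

Definition line_v (R : realType) (V : Type) (f : R[i] -> V) (z : R[i]) : R -> V :=
  fun t => f (complex.Re z +i* t).

Definition pd_u (R : realType) (V : normedModType R) (f : R[i] -> V) : R[i] -> V :=
  fun z => derive1 (line_u f z) (complex.Re z).

Definition pd_v (R : realType) (V : normedModType R) (f : R[i] -> V) : R[i] -> V :=
  fun z => derive1 (line_v f z) (complex.Im z).

(* To be used with [U] open. *)
Fixpoint Ck_on (R : realType) (V : normedModType R) (k : nat)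
    (U : set R[i]) (f : R[i] -> V) : Prop :=
  (forall z, U z -> {for z, continuous f}) /\
  if k is k'.+1 then
    [/\ forall z, U z -> derivable (line_u f z) (complex.Re z) 1,
        forall z, U z -> derivable (line_v f z) (complex.Im z) 1,
        Ck_on k' U (pd_u f) & Ck_on k' U (pd_v f)]
  else True.

Definition smooth_on (R : realType) (V : normedModType R)
    (U : set R[i]) (f : R[i] -> V) : Prop :=
  forall k, Ck_on k U f.

Definition re_part (R : realType) (f : R[i] -> R[i]) : R[i] -> R :=
  fun z => complex.Re (f z).

Definition im_part (R : realType) (f : R[i] -> R[i]) : R[i] -> R :=
  fun z => complex.Im (f z).

(* R[i] is not a normed module over R here, so real partial derivatives of
   complex-valued functions are taken componentwise. *)
Definition cpd_u (R : realType) (f : R[i] -> R[i]) : R[i] -> R[i] :=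
  fun z => pd_u (re_part f : _ -> R^o) z +i* pd_u (im_part f : _ -> R^o) z.

Definition cpd_v (R : realType) (f : R[i] -> R[i]) : R[i] -> R[i] :=
  fun z => pd_v (re_part f : _ -> R^o) z +i* pd_v (im_part f : _ -> R^o) z.

Definition d_z (R : realType) (f : R[i] -> R[i]) : R[i] -> R[i] :=
  fun z => 2^-1 * (cpd_u f z - 'i * cpd_v f z).

Definition d_zbar (R : realType) (f : R[i] -> R[i]) : R[i] -> R[i] :=
  fun z => 2^-1 * (cpd_u f z + 'i * cpd_v f z).

Definition C2_near (R : realType) (f : R[i] -> R[i]) (z : R[i]) : Prop :=
  exists U : set R[i], [/\ open U, U z,
    Ck_on 2 U (re_part f : _ -> R^o) & Ck_on 2 U (im_part f : _ -> R^o)].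

Record chart (R : realType) (S : topologicalType) := Chart {
  chart_dom : set S;
  chart_map : S -> R[i];
  chart_inv : R[i] -> S;
  chart_dom_open : open chart_dom;
  chart_image_open : open (chart_map @` chart_dom);
  chart_mapK : forall p, chart_dom p -> chart_inv (chart_map p) = p;
  chart_map_continuous : forall p, chart_dom p -> {for p, continuous chart_map};
  chart_inv_continuous :
    forall z, (chart_map @` chart_dom) z -> {for z, continuous chart_inv}
}.

Definition chart_image (R : realType) (S : topologicalType) (c : chart R S)
  : set R[i] := chart_map c @` chart_dom c.

Definition holomorphic_on (R : realType) (U : set R[i]) (f : R[i] -> R[i]) :=
  forall z, U z -> derivable f z 1.

Definition compatible (R : realType) (S : topologicalType) (c d : chart R S) :=
  holomorphic_on (chart_map c @` (chart_dom c `&` chart_dom d)) (chart_map d \o chart_inv c) /\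
  holomorphic_on (chart_map d @` (chart_dom c `&` chart_dom d)) (chart_map c \o chart_inv d).

(* As the atlas is maximal, its charts are exactly the local conformal
   coordinates.  Neither connectedness nor second countability is required. *)
Record riemann_surface (R : realType) := RiemannSurface {
  carrier :> topologicalType;
  atlas : set (chart R carrier);
  carrier_hausdorff : hausdorff_space carrier;
  atlas_cover : forall p, exists2 c, atlas c & chart_dom c p;
  atlas_compatible : forall c d, atlas c -> atlas d -> compatible c d;
  atlas_maximal :
    forall c, (forall d, atlas d -> compatible c d) -> atlas c
}.

(* Points of Nil_3 and coordinate vectors of R^3 = T_x Nil_3 are both row
   vectors. *)
Definition vec3 (R : realType) (a b c : R) : 'rV[R]_3 :=
  \row_i [:: a; b; c]`_i.

Definition x1 (R : realType) (x : 'rV[R]_3) : R := x 0 0.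
Definition x2 (R : realType) (x : 'rV[R]_3) : R := x 0 1.
Definition x3 (R : realType) (x : 'rV[R]_3) : R := x 0 2.

Definition contact (R : realType) (x a : 'rV[R]_3) : R :=
  2^-1 * (x2 x * x1 a - x1 x * x2 a) + x3 a.

Definition metric (R : realType) (x a b : 'rV[R]_3) : R :=
  x1 a * x1 b + x2 a * x2 b + contact x a * contact x b.

Definition frame (R : realType) (x : 'rV[R]_3) (i : 'I_3) : 'rV[R]_3 :=
  nth 0 [:: vec3 1 0 (- (x2 x / 2)); vec3 0 1 (x1 x / 2); vec3 0 0 1] i.

(* Coordinates in the frame (E_1, E_2, E_3), which is orthonormal. *)
Definition frame_coord (R : realType) (x a : 'rV[R]_3) : 'rV[R]_3 :=
  \row_i metric x a (frame x i).

Definition of_frame (R : realType) (x c : 'rV[R]_3) : 'rV[R]_3 :=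
  \sum_i c 0 i *: frame x i.

Definition cross3 (R : realType) (a b : 'rV[R]_3) : 'rV[R]_3 :=
  vec3 (x2 a * x3 b - x3 a * x2 b)
       (x3 a * x1 b - x1 a * x3 b)
       (x1 a * x2 b - x2 a * x1 b).

Definition cross (R : realType) (x a b : 'rV[R]_3) : 'rV[R]_3 :=
  of_frame x (cross3 (frame_coord x a) (frame_coord x b)).

Definition basis3 (R : realType) (i : 'I_3) : 'rV[R]_3 := delta_mx 0 i.

Definition metric_mx (R : realType) (x : 'rV[R]_3) : 'M[R]_3 :=
  \matrix_(i, j) metric x (basis3 R i) (basis3 R j).

Definition d_metric (R : realType) (i j k : 'I_3) (x : 'rV[R]_3) : R :=
  'D_(basis3 R i) (fun y => metric_mx y j k : R^o) x.

(* Gamma^k_ij of the Levi-Civita connection, in the coordinates (x1, x2, x3). *)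
Definition christoffel (R : realType) (x : 'rV[R]_3) (k i j : 'I_3) : R :=
  2^-1 * \sum_l invmx (metric_mx x) k l *
                (d_metric i j l x + d_metric j i l x - d_metric l i j x).

Definition connection (R : realType) (x a b : 'rV[R]_3) : 'rV[R]_3 :=
  \row_k \sum_i \sum_j christoffel x k i j * a 0 i * b 0 j.

(* Covariant derivatives, in the directions d/du and d/dv, of a vector field
   [W] along [Y]. *)
Definition nabla_u (R : realType) (Y W : R[i] -> 'rV[R]_3) (z : R[i]) :=
  pd_u W z + connection (Y z) (pd_u Y z) (W z).

Definition nabla_v (R : realType) (Y W : R[i] -> 'rV[R]_3) (z : R[i]) :=
  pd_v W z + connection (Y z) (pd_v Y z) (W z).

Definition unit_normal (R : realType) (Y : R[i] -> 'rV[R]_3) (z : R[i])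
  : 'rV[R]_3 :=
  let n := cross (Y z) (pd_u Y z) (pd_v Y z) in
  (Num.sqrt (metric (Y z) n n))^-1 *: n.

Definition mean_curvature (R : realType) (Y : R[i] -> 'rV[R]_3) (z : R[i]) : R :=
  let I a b := metric (Y z) a b in
  let E := I (pd_u Y z) (pd_u Y z) in
  let F := I (pd_u Y z) (pd_v Y z) in
  let G := I (pd_v Y z) (pd_v Y z) in
  let L := I (nabla_u Y (pd_u Y) z) (unit_normal Y z) in
  let M := I (nabla_u Y (pd_v Y) z) (unit_normal Y z) in
  let N := I (nabla_v Y (pd_v Y) z) (unit_normal Y z) in
  (L * G - 2 * M * F + N * E) / (2 * (E * G - F ^+ 2)).

Definition smooth_map (R : realType) (S : riemann_surface R)
    (X : S -> 'rV[R]_3) : Prop :=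
  forall c, atlas c -> smooth_on (chart_image c) (X \o chart_inv c).

Definition immersion (R : realType) (S : riemann_surface R)
    (X : S -> 'rV[R]_3) : Prop :=
  forall c, atlas c -> forall z, chart_image c z ->
    row_free (col_mx (pd_u (X \o chart_inv c) z) (pd_v (X \o chart_inv c) z)).

Definition conformal (R : realType) (S : riemann_surface R)
    (X : S -> 'rV[R]_3) : Prop :=
  forall c, atlas c -> forall z, chart_image c z ->
    let Y := X \o chart_inv c in
    metric (Y z) (pd_u Y z) (pd_u Y z) = metric (Y z) (pd_v Y z) (pd_v Y z) /\
    metric (Y z) (pd_u Y z) (pd_v Y z) = 0.

Definition minimal (R : realType) (S : riemann_surface R)
    (X : S -> 'rV[R]_3) : Prop :=
  forall c, atlas c -> forall z, chart_image c z ->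
    mean_curvature (X \o chart_inv c) z = 0.

(* [None] is the point at infinity. *)
Definition extC (R : realType) := one_point_compactification R[i].

Definition inv_stereo (R : realType) (w : extC R) : 'rV[R]_3 :=
  match w with
  | None => vec3 0 0 (-1)
  | Some g =>
      let n := complex.Re g ^+ 2 + complex.Im g ^+ 2 in
      (1 + n)^-1 *: vec3 (2 * complex.Re g) (2 * complex.Im g) (1 - n)
  end.

Definition is_gauss_map (R : realType) (S : riemann_surface R)
    (X : S -> 'rV[R]_3) (g : S -> extC R) : Prop :=
  forall c, atlas c -> forall p, chart_dom c p ->
    frame_coord (X p) (unit_normal (X \o chart_inv c) (chart_map c p)) =
    inv_stereo (g p).

Definition ext_inv (R : realType) (w : extC R) : extC R :=
  match w with
  | None => Some 0
  | Some g => if g == 0 then None else Some g^-1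
  end.

Definition finite_part (R : realType) (w : extC R) : R[i] :=
  if w is Some g then g else 0.

(* The value of [finite_part] at infinity is irrelevant: [h] is finite at [p],
   and continuity of [h] makes it finite near [p]. *)
Definition gauss_equation_at (R : realType) (S : riemann_surface R)
    (h : S -> extC R) (c : chart R S) (p : S) : Prop :=
  let f z := finite_part (h (chart_inv c z)) in
  let z0 := chart_map c p in
  [/\ h p <> None, C2_near f z0 &
      (1 - `|f z0| ^+ 2) * d_zbar (d_z f) z0
        + 2 * (f z0)^* * d_z f z0 * d_zbar f z0 = 0].

(* Main.v *)
Require Import Defs.
From mathcomp Require Import all_boot all_order all_algebra.
From mathcomp Require Import complex.
From mathcomp Require Import all_classical all_reals all_analysis.
From mathcomp Require Import ring lra.

(** In the left-invariant frame, let p and q be the coordinates of X_u and X_v,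
    put phi = p - i q, and set
      alpha = phi_1 + i phi_2,  beta = phi_1 - i phi_2,  gamma = phi_3.
    Conformality says alpha beta = - gamma^2 ([spinor_relation]), and the
    stereographic coordinate of the normal p x q is then determined by
      gamma = - conj(g) alpha,
    with g infinite exactly where alpha vanishes ([stereo_finite],
    [stereo_infinite]).  So g is a smooth quotient wherever it is finite.

    For a conformal immersion, H = 0 means that the tension field
    nabla_u X_u + nabla_v X_v vanishes: its tangential part is zero because of
    conformality ([tension_vanishes]), its normal part is a multiple of H
    ([normal_tension]).  Together with the identity
    nabla_v X_u = nabla_u X_v this is a first order system for (p, q)
    ([minimal_frame], [minimal_frame_immersion]), which gives the
    zbar-derivatives of alpha and gamma as quadratic expressions in alpha, beta,
    gamma and their conjugates ([dzbar_alpha], [dzbar_gamma]).  Substituting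
    gamma = - conj(g) alpha and beta = - conj(g)^2 alpha leaves, with
    e = i/8,
      g_z = e alpha (1 - |g|^2)^2,
      alpha_zbar = - 2 e g |alpha|^2 (1 - |g|^2).
    Differentiating the first equation with respect to zbar and using the second,
    the terms containing |alpha|^2 cancel, and what remains is the equation of
    the theorem ([gauss_equation_of_spinor]).  At no point is there a division by
    1 - |g|^2, so points with a horizontal normal need no separate treatment.

    The half-turn about the E_1 axis is an isometry of Nil_3 preserving the
    orientation; it maps minimal frames to minimal frames
    ([minimal_frame_rotate]) and g to 1/g ([inv_stereo_rotate]).  This gives the
    equation for 1/g near the points where g is infinite. *)

Set Implicit Arguments.
Unset Strict Implicit.
Unset Printing Implicit Defensive.

Import Order.TTheory GRing.Theory Num.Theory.
Import numFieldNormedType.Exports.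

Local Open Scope classical_set_scope.
Local Open Scope ring_scope.
Local Open Scope complex_scope.

(** * Partial derivatives and C^k functions on the plane *)

(** The topology of R[i] comes from the modulus, while partial derivatives live on
    horizontal and vertical lines; squares are what connects the two. *)
Lemma nbhs_box (R : realType) (z : R[i]) (U : set R[i]) :
  nbhs z U -> exists2 e : R, 0 < e & forall u v : R,
     `|u - complex.Re z| < e -> `|v - complex.Im z| < e -> U (u +i* v).
Proof.
case: z => a b /nbhs_ballP[[e e'] /= /[!ltcE]/= /andP[/eqP -> e0] eU].
exists (e / 2) => [|u v hu hv]; first by rewrite divr_gt0.
apply: eU; rewrite -ball_normE /=.
have -> : (a +i* b) - (u +i* v) = (a - u)%:C + 'i * (b - v)%:C :> R[i].
  by apply/eqP; rewrite eq_complex /=; apply/andP; split; apply/eqP; ring.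
apply: le_lt_trans (ler_normD _ _) _.
(* The modulus is at most the sum of the moduli of the two coordinates, whence the
   half-radius chosen above. *)
rewrite normrM !normc_def /= expr0n /= expr1n addr0 add0r sqrtr1 mul1r.
rewrite -rmorphD /= ltcR.
rewrite ?expr0n /= ?addr0 !sqrtr_sqr [e]splitr ltrD// distrC//.
Qed.

Section partials.
Variable R : realType.
Implicit Types (U : set R[i]) (z : R[i]).

Lemma near_line_u U z : open U -> U z ->
  \forall t \near complex.Re z, U (t +i* complex.Im z).
Proof.
move=> oU Uz; have /nbhs_box[e e0 eU] := open_nbhs_nbhs (conj oU Uz).
apply/nbhs_ballP; exists e => //= t; rewrite /ball /= distrC => te.
by apply: eU => //; rewrite subrr normr0.
Qed.

Lemma near_line_v U z : open U -> U z ->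
  \forall t \near complex.Im z, U (complex.Re z +i* t).
Proof.
move=> oU Uz; have /nbhs_box[e e0 eU] := open_nbhs_nbhs (conj oU Uz).
apply/nbhs_ballP; exists e => //= t; rewrite /ball /= distrC => te.
by apply: eU => //; rewrite subrr normr0.
Qed.

(** A relational form of the partial derivatives: the rules of calculus then
    compose as terms, without separate proofs of differentiability. *)
Definition has_partials (V : normedModType R) (f : R[i] -> V) z (a b : V) :=
  is_derive (complex.Re z) 1 (line_u f z) a /\
  is_derive (complex.Im z) 1 (line_v f z) b.

Section vector_valued.
Variable V : normedModType R.
Implicit Types f g : R[i] -> V.

Lemma has_partials_pd f z a b :
  has_partials f z a b -> pd_u f z = a /\ pd_v f z = b.
Proof.
case: z => x y; case=> fa fb; split.
- by rewrite /pd_u derive1E derive_val.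
- by rewrite /pd_v derive1E derive_val.
Qed.

Lemma has_partials_ext U f g z a b : open U -> U z ->
  (forall w, U w -> f w = g w) -> has_partials f z a b -> has_partials g z a b.
Proof.
move=> oU Uz fg [fa fb]; split.
- apply: near_eq_is_derive fa; apply: filterS (near_line_u oU Uz) => t.
  exact: fg.
- apply: near_eq_is_derive fb; apply: filterS (near_line_v oU Uz) => t.
  exact: fg.
Qed.

(** An identity between functions on an open set may be differentiated. *)
Lemma has_partials_inj U f g z a b c d : open U -> U z ->
  (forall w, U w -> f w = g w) ->
  has_partials f z a b -> has_partials g z c d -> a = c /\ b = d.
Proof.
move=> oU Uz fg fab /has_partials_pd[<- <-].
by have [-> ->] := has_partials_pd (has_partials_ext oU Uz fg fab).
Qed.

Lemma has_partials_eq f z a b a' b' :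
  has_partials f z a b -> a = a' -> b = b' -> has_partials f z a' b'.
Proof. by move=> fab <- <-. Qed.

Lemma Ck_partials k U f z : Ck_on k.+1 U f -> U z ->
  has_partials f z (pd_u f z) (pd_v f z).
Proof.
move=> [_ [du dv _ _]] Uz; split.
- by apply: DeriveDef; [exact: du|rewrite /pd_u derive1E].
- by apply: DeriveDef; [exact: dv|rewrite /pd_v derive1E].
Qed.

Lemma Ck_continuous k U f z : Ck_on k U f -> U z -> {for z, continuous f}.
Proof. by case: k => [|k] [+ _] Uz; exact. Qed.

Lemma Ck_pd_u k U f : Ck_on k.+1 U f -> Ck_on k U (pd_u f).
Proof. by case=> _ []. Qed.

Lemma Ck_pd_v k U f : Ck_on k.+1 U f -> Ck_on k U (pd_v f).
Proof. by case=> _ []. Qed.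

Lemma continuous_ext U f g z : open U -> U z ->
  (forall w, U w -> f w = g w) ->
  {for z, continuous f} -> {for z, continuous g}.
Proof.
move=> oU Uz fg; rewrite /prop_for /continuous_at (fg z Uz).
apply: cvg_trans; apply: (@near_eq_cvg _ _ (nbhs z)).
by apply: filterS (open_nbhs_nbhs (conj oU Uz)) => w Uw; rewrite fg.
Qed.

Lemma Ck_ext k U f g : open U -> (forall w, U w -> f w = g w) ->
  Ck_on k U f -> Ck_on k U g.
Proof.
move=> oU; elim: k f g => [|k IH] f g fg fk.
all: have cg z (Uz : U z) : {for z, continuous g} by
  exact: (continuous_ext oU Uz fg (Ck_continuous fk Uz)).
  by split.
have pg z : U z -> has_partials g z (pd_u f z) (pd_v f z).
  by move=> Uz; apply: has_partials_ext fg _ => //; exact: Ck_partials fk Uz.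
have [_ [_ _ fu fv]] := fk.
split=> //; split.
- by move=> z /pg[[]].
- by move=> z /pg[_ []].
- by apply: IH fu => z /pg /has_partials_pd[].
- by apply: IH fv => z /pg /has_partials_pd[].
Qed.

(** [Ck_on] speaks of the functions [pd_u f] and [pd_v f] themselves; closure
    properties only provide functions that agree with them on [U]. *)
Lemma CkS k U f a b : open U ->
  (forall z, U z -> {for z, continuous f}) ->
  (forall z, U z -> has_partials f z (a z) (b z)) ->
  Ck_on k U a -> Ck_on k U b -> Ck_on k.+1 U f.
Proof.
move=> oU cf pf ak bk; split=> //; split.
- by move=> z /pf[[]].
- by move=> z /pf[_ []].
- by apply: Ck_ext ak => // z /pf/has_partials_pd[->].
- by apply: Ck_ext bk => // z /pf/has_partials_pd[_ ->].
Qed.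

Lemma CkW k U f : Ck_on k.+1 U f -> Ck_on k U f.
Proof.
elim: k f => [|k IH] f [cf [du dv fu fv]]; first by split.
by split; [exact: cf|split; [exact: du|exact: dv|exact: (IH _ fu)|exact: (IH _ fv)]].
Qed.

Lemma Ck_sub k U W f : W `<=` U -> Ck_on k U f -> Ck_on k W f.
Proof.
move=> WU; elim: k f => [|k IH] f [cf fk].
  by split=> // z /WU; exact: cf.
case: fk => du dv fu fv; split; [by move=> z /WU; exact: cf|split].
- by move=> z /WU; exact: du.
- by move=> z /WU; exact: dv.
- exact: IH.
- exact: IH.
Qed.

Lemma has_partials_cst (c : V) z : has_partials (fun=> c) z 0 0.
Proof. by split; exact: is_derive_cst. Qed.

Lemma has_partialsD f g z a b c d : has_partials f z a b ->
  has_partials g z c d -> has_partials (fun w => f w + g w) z (a + c) (b + d).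
Proof. by move=> [fa fb] [ga gb]; split; [exact: (is_deriveD fa ga)|exact: (is_deriveD fb gb)]. Qed.

Lemma has_partialsN f z a b : has_partials f z a b ->
  has_partials (fun w => - f w) z (- a) (- b).
Proof. by move=> [fa fb]; split; [exact: (is_deriveN fa)|exact: (is_deriveN fb)]. Qed.

Lemma Ck_cst k U (c : V) : open U -> Ck_on k U (fun=> c).
Proof.
move=> oU; elim: k c => [|k IH] c; first by split=> // z _; exact: cst_continuous.
apply: (@CkS _ _ _ (fun=> 0) (fun=> 0)) => // z _; first exact: cst_continuous.
exact: has_partials_cst.
Qed.

Lemma CkD k U f g : open U -> Ck_on k U f -> Ck_on k U g ->
  Ck_on k U (fun w => f w + g w).
Proof.
move=> oU; elim: k f g => [|k IH] f g fk gk.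
all: have cD z : U z -> {for z, continuous (fun w => f w + g w)} by
  move=> Uz; apply: continuousD; [exact: Ck_continuous fk Uz|exact: Ck_continuous gk Uz].
  by split.
have [[_ [_ _ fu fv]] [_ [_ _ gu gv]]] := (fk, gk).
apply: (CkS oU cD _ (IH _ _ fu gu) (IH _ _ fv gv)) => z Uz.
by apply: has_partialsD; [exact: Ck_partials fk Uz|exact: Ck_partials gk Uz].
Qed.

Lemma CkN k U f : open U -> Ck_on k U f -> Ck_on k U (fun w => - f w).
Proof.
move=> oU; elim: k f => [|k IH] f fk.
all: have cN z : U z -> {for z, continuous (fun w => - f w)} by
  move=> Uz; apply: continuousN; exact: Ck_continuous fk Uz.
  by split.
have [_ [_ _ fu fv]] := fk.
apply: (CkS oU cN _ (IH _ fu) (IH _ fv)) => z Uz.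
by apply: has_partialsN; exact: Ck_partials fk Uz.
Qed.

End vector_valued.

Section real_valued.
Implicit Types f g : R[i] -> R^o.

Lemma has_partialsM f g z (a b c d : R) : has_partials f z a b ->
  has_partials g z c d ->
  has_partials (fun w => f w * g w : R^o) z (a * g z + f z * c) (b * g z + f z * d).
Proof.
case: z => x y [fa fb] [ga gb]; split.
- by apply: is_derive_eq (is_deriveM fa ga) _; rewrite addrC mulrC.
- by apply: is_derive_eq (is_deriveM fb gb) _; rewrite addrC mulrC.
Qed.

Lemma has_partialsV f z (a b : R) : f z != 0 -> has_partials f z a b ->
  has_partials (fun w => (f w)^-1 : R^o) z
    (- (a * ((f z)^-1 * (f z)^-1))) (- (b * ((f z)^-1 * (f z)^-1))).
Proof.
case: z => x y fz [fa fb]; split.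
- have df := @ex_derive _ _ _ _ _ _ _ fa.
  apply: DeriveDef; first exact: derivableV.
  by rewrite deriveV // derive_val /GRing.scale /= -exprVn expr2; ring.
- have df := @ex_derive _ _ _ _ _ _ _ fb.
  apply: DeriveDef; first exact: derivableV.
  by rewrite deriveV // derive_val /GRing.scale /= -exprVn expr2; ring.
Qed.

Lemma CkM k U f g : open U -> Ck_on k U f -> Ck_on k U g ->
  Ck_on k U (fun w => f w * g w : R^o).
Proof.
move=> oU; elim: k f g => [|k IH] f g fk gk.
all: have cM z : U z -> {for z, continuous (fun w => f w * g w : R^o)} by
  move=> Uz; apply: continuousM; [exact: Ck_continuous fk Uz|exact: Ck_continuous gk Uz].
  by split.
have [[_ [_ _ fu fv]] [_ [_ _ gu gv]]] := (fk, gk).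
have [fk' gk'] := (CkW fk, CkW gk).
apply: (CkS oU cM _ (CkD oU (IH _ _ fu gk') (IH _ _ fk' gu))
                    (CkD oU (IH _ _ fv gk') (IH _ _ fk' gv))) => z Uz.
by apply: has_partialsM; [exact: Ck_partials fk Uz|exact: Ck_partials gk Uz].
Qed.

Lemma CkV k U f : open U -> (forall z, U z -> f z != 0) -> Ck_on k U f ->
  Ck_on k U (fun w => (f w)^-1 : R^o).
Proof.
move=> oU f0; elim: k => [|k IH] fk.
all: have cV z : U z -> {for z, continuous (fun w => (f w)^-1 : R^o)} by
  move=> Uz; apply: continuousV; [exact: f0|exact: Ck_continuous fk Uz].
  by split.
have [_ [_ _ fu fv]] := fk.
have Vk := IH (CkW fk).
apply: (CkS oU cV _ (CkN oU (CkM oU fu (CkM oU Vk Vk)))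
                    (CkN oU (CkM oU fv (CkM oU Vk Vk)))) => z Uz.
by apply: has_partialsV; [exact: f0|exact: Ck_partials fk Uz].
Qed.

End real_valued.
End partials.

(** * Equality of mixed partial derivatives *)

Lemma MVT_step (R : realType) (G dG : R -> R) (c h : R) : 0 < h ->
  (forall t, c <= t <= c + h -> is_derive t 1 G (dG t)) ->
  exists2 t, c <= t <= c + h & G (c + h) - G c = dG t * h.
Proof.
move=> h0 GdG.
have itvE t : t \in `[c, c + h] -> c <= t <= c + h by rewrite in_itv.
have [t tc ->] : exists2 t, t \in `]c, c + h[ &
    G (c + h) - G c = dG t * (c + h - c).
  apply: MVT; first by rewrite ltrDl.
  - by move=> t tc; apply: GdG; apply: itvE; exact: subset_itv_oo_cc tc.
  - apply: derivable_within_continuous => t tc.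
    by have [] := GdG t (itvE t tc).
exists t; first by apply: itvE; exact: subset_itv_oo_cc tc.
by rewrite addrAC subrr add0r.
Qed.

(** The mean value theorem applied first in u, to the difference of two horizontal
    slices, then in v.  The second difference is symmetric in the two variables, so
    exchanging them produces a value of the other mixed derivative. *)
Lemma second_difference_MVT (R : realType) (F Fu Fuv : R -> R -> R) (a b e h : R) :
  (forall u v, `|u - a| < e -> `|v - b| < e ->
     is_derive u 1 (F^~ v) (Fu u v)) ->
  (forall u v, `|u - a| < e -> `|v - b| < e ->
     is_derive v 1 (Fu u) (Fuv u v)) ->
  0 < h < e ->
  exists u v, [/\ `|u - a| <= h, `|v - b| <= h &
    F (a + h) (b + h) - F (a + h) b - F a (b + h) + F a b = Fuv u v * h * h].
Proof.
move=> dF dFu /andP[h0 he].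
have inbox (c t : R) : c <= t <= c + h -> `|t - c| <= h.
  by move=> /andP[ct tc]; rewrite ger0_norm ?subr_ge0//; lra.
have inboxe (c t : R) : c <= t <= c + h -> `|t - c| < e.
  by move=> /inbox; move/le_lt_trans; exact.
have bb : b <= b <= b + h by rewrite lexx lerDl ltW.
have bh : b <= b + h <= b + h by rewrite lexx lerDl ltW.
have dphi u : a <= u <= a + h -> is_derive u 1
    ((F^~ (b + h) : R -> R^o) - (F^~ b : R -> R^o)) (Fu u (b + h) - Fu u b).
  by move=> ua; apply: is_deriveB; apply: dF; exact: inboxe.
have [u ua Eu] := MVT_step h0 dphi.
have [v vb Ev] := MVT_step h0 (fun v vb => dFu u v (inboxe _ _ ua) (inboxe _ _ vb)).
exists u, v; split; [exact: inbox|exact: inbox|].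
rewrite -Ev -Eu !fctE /=; ring.
Qed.

Lemma dist_le_halves (R : realFieldType) (p q s d : R) :
  `|p - s| < d / 2 -> `|q - s| < d / 2 -> `|p - q| <= d.
Proof.
move=> ps qs; rewrite (le_trans (ler_distD s _ _))// [d]splitr.
by apply/ltW/ltrD => //; rewrite distrC.
Qed.

(** Both mixed derivatives take the same value, at two points as close to [z] as
    desired; continuity carries the equality to [z]. *)
Lemma schwarz (R : realType) (U : set R[i]) (f : R[i] -> R^o) (z : R[i]) :
  open U -> Ck_on 2 U f -> U z -> pd_v (pd_u f) z = pd_u (pd_v f) z.
Proof.
move=> oU f2 Uz; have [fu fv] := (Ck_pd_u f2, Ck_pd_v f2).
have [fuv fvu] := (Ck_pd_v fu, Ck_pd_u fv).
apply/eqP; rewrite -subr_eq0 -normr_le0; apply/ler_addgt0Pr => d d0.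
have d2 : 0 < d / 2 by rewrite divr_gt0.
have near_diag (g : R[i] -> R^o) : {for z, continuous g} ->
    nbhs z [set w | `|g z - g w| < d / 2].
  by move/cvgrPdist_lt => /(_ _ d2).
case: z Uz near_diag => a b Uz near_diag.
have : nbhs (a +i* b) (U `&` ([set w | `|pd_v (pd_u f) (a +i* b) - pd_v (pd_u f) w| < d / 2]
    `&` [set w | `|pd_u (pd_v f) (a +i* b) - pd_u (pd_v f) w| < d / 2])).
  apply: filterI; first exact: open_nbhs_nbhs.
  by apply: filterI; apply: near_diag; [exact: (Ck_continuous fuv)|exact: (Ck_continuous fvu)].
move=> /nbhs_box [e e0 /= eU].
have he : 0 < e / 2 < e by rewrite divr_gt0//= ltr_pdivrMr// ltr_pMr// ltr1n.
have inU u v : `|u - a| < e -> `|v - b| < e -> U (u +i* v).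
  by move=> ua vb; have [] := eU u v ua vb.
have [u [v [ua vb E1]]] := @second_difference_MVT R (fun u v => f (u +i* v))
  (fun u v => pd_u f (u +i* v)) (fun u v => pd_v (pd_u f) (u +i* v)) a b e (e / 2)
  (fun u v ua vb => (Ck_partials f2 (inU u v ua vb)).1)
  (fun u v ua vb => (Ck_partials fu (inU u v ua vb)).2) he.
have [v' [u' [vb' ua' E2]]] := @second_difference_MVT R (fun v u => f (u +i* v))
  (fun v u => pd_v f (u +i* v)) (fun v u => pd_u (pd_v f) (u +i* v)) b a e (e / 2)
  (fun v u vb ua => (Ck_partials f2 (inU u v ua vb)).2)
  (fun v u vb ua => (Ck_partials fv (inU u v ua vb)).1) he.
have {}he : e / 2 < e by case/andP: he.
have [_ [A1 _]] := eU u v (le_lt_trans ua he) (le_lt_trans vb he).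
have [_ [_ A2]] := eU u' v' (le_lt_trans ua' he) (le_lt_trans vb' he).
have E : pd_v (pd_u f) (u +i* v) = pd_u (pd_v f) (u' +i* v').
  have h0 : e / 2 != 0 by rewrite gt_eqF ?divr_gt0.
  apply: (mulIf h0); apply: (mulIf h0).
  apply: etrans (esym E1) _; apply: etrans E2.
  by congr (_ + _); exact: addrAC.
rewrite add0r; apply: dist_le_halves A1 _; rewrite E; exact: A2.
Qed.

(** * Wirtinger derivatives *)

Section wirtinger.
Variable R : realType.
Implicit Types (U : set R[i]) (z a b c d : R[i]) (f g : R[i] -> R[i]).
Local Notation Re := complex.Re.
Local Notation Im := complex.Im.

Lemma complex_eq (x y : R[i]) : Re x = Re y -> Im x = Im y -> x = y.
Proof. by case: x y => [a b] [c d] /= -> ->. Qed.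

Lemma half_complex (x y : R) : 2^-1 * (x +i* y) = (x / 2) +i* (y / 2) :> R[i].
Proof.
have -> : x +i* y = 2 * ((x / 2) +i* (y / 2)) :> R[i].
  by apply: complex_eq => /=; field.
by rewrite mulKf// pnatr_eq0.
Qed.

(** [a] and [b] are the derivatives in z and zbar, so that the derivatives in u and
    v are a + b and i (a - b). *)
Definition has_wirtinger f z a b :=
  has_partials (re_part f : _ -> R^o) z (Re (a + b)) (Re ('i * (a - b))) /\
  has_partials (im_part f : _ -> R^o) z (Im (a + b)) (Im ('i * (a - b))).

Lemma has_wirtinger_d f z a b :
  has_wirtinger f z a b -> d_z f z = a /\ d_zbar f z = b.
Proof.
case=> /has_partials_pd[fu fv] /has_partials_pd[gu gv].
rewrite /d_z /d_zbar /cpd_u /cpd_v fu fv gu gv.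
case: a b {fu fv gu gv} => [a a'] [b b'].
by split; apply: (@mulfI _ 2); rewrite ?pnatr_eq0// mulVKf ?pnatr_eq0//;
  apply: complex_eq => /=; ring.
Qed.

Lemma has_wirtinger_ext U f g z a b : open U -> U z ->
  (forall w, U w -> f w = g w) -> has_wirtinger f z a b -> has_wirtinger g z a b.
Proof.
move=> oU Uz fg [fr fi].
by split; [apply: (has_partials_ext oU Uz _ fr)|apply: (has_partials_ext oU Uz _ fi)]
  => w Uw; rewrite /re_part /im_part fg.
Qed.

Lemma has_wirtinger_partials f z (a b c d : R) :
  has_partials (re_part f : _ -> R^o) z a b ->
  has_partials (im_part f : _ -> R^o) z c d ->
  has_wirtinger f z (2^-1 * ((a + d) +i* (c - b))) (2^-1 * ((a - d) +i* (c + b))).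
Proof.
move=> fr fi; rewrite !half_complex.
by split; [apply: has_partials_eq fr _ _|apply: has_partials_eq fi _ _] => /=; field.
Qed.

Lemma has_wirtinger_eq f z a b c d :
  has_wirtinger f z a b -> a = c -> b = d -> has_wirtinger f z c d.
Proof. by move=> fab <- <-. Qed.

Lemma has_wirtinger_Ck k U f z :
  Ck_on k.+1 U (re_part f : _ -> R^o) -> Ck_on k.+1 U (im_part f : _ -> R^o) ->
  U z -> has_wirtinger f z (d_z f z) (d_zbar f z).
Proof.
move=> fr fi Uz.
have fw := has_wirtinger_partials (Ck_partials fr Uz) (Ck_partials fi Uz).
by have [-> ->] := has_wirtinger_d fw.
Qed.

Lemma has_wirtinger_cst c z : has_wirtinger (fun=> c) z 0 0.
Proof.
split.
all: apply: has_partials_eq (has_partials_cst _ z) _ _ => /=; ring.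
Qed.

Lemma has_wirtingerD f g z a b c d : has_wirtinger f z a b ->
  has_wirtinger g z c d -> has_wirtinger (fun w => f w + g w) z (a + c) (b + d).
Proof.
move=> [fr fi] [gr gi]; split.
- have -> : re_part (fun w => f w + g w) = fun w => re_part f w + re_part g w.
    by apply/funext => w; rewrite /re_part; case: (f w) (g w) => ? ? [].
  apply: has_partials_eq (has_partialsD fr gr) _ _;
    case: a b c d {fr fi gr gi} => [? ?] [? ?] [? ?] [? ?] /=; ring.
- have -> : im_part (fun w => f w + g w) = fun w => im_part f w + im_part g w.
    by apply/funext => w; rewrite /im_part; case: (f w) (g w) => ? ? [].
  apply: has_partials_eq (has_partialsD fi gi) _ _;
    case: a b c d {fr fi gr gi} => [? ?] [? ?] [? ?] [? ?] /=; ring.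
Qed.

Lemma has_wirtingerM f g z a b c d : has_wirtinger f z a b ->
  has_wirtinger g z c d ->
  has_wirtinger (fun w => f w * g w) z (a * g z + f z * c) (b * g z + f z * d).
Proof.
move=> [fr fi] [gr gi]; split.
- have -> : re_part (fun w => f w * g w) =
      fun w => re_part f w * re_part g w + - (im_part f w * im_part g w).
    by apply/funext => w; rewrite /re_part /im_part; case: (f w) (g w) => ? ? [].
  apply: has_partials_eq (has_partialsD (has_partialsM fr gr)
    (has_partialsN (has_partialsM fi gi))) _ _;
  rewrite /re_part /im_part; case: a b c d (f z) (g z) {fr fi gr gi}
    => [? ?] [? ?] [? ?] [? ?] [? ?] [? ?] /=; ring.
- have -> : im_part (fun w => f w * g w) =
      fun w => re_part f w * im_part g w + im_part f w * re_part g w.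
    by apply/funext => w; rewrite /re_part /im_part; case: (f w) (g w) => ? ? [].
  apply: has_partials_eq (has_partialsD (has_partialsM fr gi)
    (has_partialsM fi gr)) _ _;
  rewrite /re_part /im_part; case: a b c d (f z) (g z) {fr fi gr gi}
    => [? ?] [? ?] [? ?] [? ?] [? ?] [? ?] /=; ring.
Qed.

Lemma has_wirtinger_conj f z a b : has_wirtinger f z a b ->
  has_wirtinger (fun w => conjc (f w)) z (conjc b) (conjc a).
Proof.
move=> [fr fi]; split.
- have -> : re_part (fun w => conjc (f w)) = re_part f.
    by apply/funext => w; rewrite /re_part; case: (f w).
  apply: has_partials_eq fr _ _; case: a b {fi} => [? ?] [? ?] /=; ring.
- have -> : im_part (fun w => conjc (f w)) = fun w => - im_part f w.
    by apply/funext => w; rewrite /im_part; case: (f w).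
  apply: has_partials_eq (has_partialsN fi) _ _;
    case: a b {fr fi} => [? ?] [? ?] /=; ring.
Qed.

End wirtinger.

Lemma conjcM (R : realType) (a b : R[i]) : conjc (a * b) = conjc a * conjc b.
Proof. by apply: complex_eq; case: a b => [a a'] [b b'] /=; ring. Qed.

Lemma conjcB (R : realType) (a b : R[i]) : conjc (a - b) = conjc a - conjc b.
Proof. by apply: complex_eq; case: a b => [a a'] [b b'] /=; ring. Qed.

Lemma conjcN (R : realType) (a : R[i]) : conjc (- a) = - conjc a.
Proof. by case: a. Qed.

(** The z-derivative of [f] is an explicit function of [A] and [f], so the second
    derivative is obtained by differentiating it once more with the product rule.
    The derivative of 1 - |f|^2 contains the conjugate of [d_z f], and the
    resulting multiple of |A|^2 is compensated by the derivative of [A]; this is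
    where [e] being purely imaginary is used. *)
Lemma gauss_equation_of_spinor (R : realType) (U : set R[i]) (e : R[i])
    (f A : R[i] -> R[i]) (z : R[i]) :
  open U -> U z -> conjc e = - e ->
  Ck_on 2 U (re_part f : _ -> R^o) -> Ck_on 2 U (im_part f : _ -> R^o) ->
  (forall w, U w -> d_z f w = e * A w * (1 - f w * conjc (f w)) ^+ 2) ->
  has_wirtinger A z (d_z A z)
    (- (2 * e) * f z * (A z * conjc (A z)) * (1 - f z * conjc (f z))) ->
  (1 - `|f z| ^+ 2) * d_zbar (d_z f) z
    + 2 * conjc (f z) * d_z f z * d_zbar f z = 0.
Proof.
move=> oU Uz ee fr fi fE Aw.
have fw := has_wirtinger_Ck fr fi Uz.
have cw c := has_wirtinger_cst c z.
have ffw := has_wirtingerM fw (has_wirtinger_conj fw).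
have sw := has_wirtingerD (cw 1) (has_wirtingerM (cw (-1)) ffw).
have := has_wirtingerM (cw e) (has_wirtingerM Aw (has_wirtingerM sw sw)).
move=> /(has_wirtinger_ext (g := d_z f) oU Uz) [] => [w Uw|].
  by rewrite fE// mulN1r expr2 !mulrA.
rewrite sqr_normc.
move=> dr di; have [_ ->] := has_wirtinger_d (conj dr di).
rewrite fE// expr2 !(conjcM, conjcB, conjcK, conjc1) ee.
move: (f z) (conjc (f z)) (d_zbar f z) (A z) (conjc (A z)) (d_z A z) => F F' q a a' da.
ring.
Qed.

(** * Stereographic projection of the normal of a conformal pair *)

Section conformal_pair.
Variables (R : realType) (p1 p2 p3 q1 q2 q3 : R).
Hypothesis pp_qq : p1 ^+ 2 + p2 ^+ 2 + p3 ^+ 2 = q1 ^+ 2 + q2 ^+ 2 + q3 ^+ 2.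
Hypothesis pq0 : p1 * q1 + p2 * q2 + p3 * q3 = 0.
Let E := p1 ^+ 2 + p2 ^+ 2 + p3 ^+ 2.
Hypothesis E0 : E != 0.
Let n := cross3 (vec3 p1 p2 p3) (vec3 q1 q2 q3).

Let nE : n = vec3 (p2 * q3 - p3 * q2) (p3 * q1 - p1 * q3) (p1 * q2 - p2 * q1).
Proof. by rewrite /n /cross3 /x1 /x2 /x3 /vec3 !mxE. Qed.

Let alpha := (p1 + q2) +i* (p2 - q1).
Let gamma := p3 -i* q3.

(** The real and imaginary parts are the two conformality conditions, that is
    phi_1^2 + phi_2^2 + phi_3^2 = 0 for phi = p - i q. *)
Lemma spinor_relation :
  alpha * ((p1 - q2) -i* (p2 + q1)) = - (gamma * gamma).
Proof.
apply: complex_eq => /=; apply/eqP; rewrite -subr_eq0; apply/eqP.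
  by transitivity (E - (q1 ^+ 2 + q2 ^+ 2 + q3 ^+ 2)); [rewrite /E; ring|rewrite /E pp_qq subrr].
transitivity (- 2 * (p1 * q1 + p2 * q2 + p3 * q3)); [ring|by rewrite pq0 mulr0].
Qed.

(** Real and imaginary part of
    conj(alpha) (n_1 + i n_2) = - conj(gamma) (|p|^2 + n_3); they hold because the
    orthogonal triple p, q, n = p x q satisfies q x n = |q|^2 p and
    n x p = |p|^2 q. *)
Lemma spinor_normal :
  (p1 + q2) * (p2 * q3 - p3 * q2) + (p2 - q1) * (p3 * q1 - p1 * q3) =
    - p3 * (E + (p1 * q2 - p2 * q1)) /\
  (p1 + q2) * (p3 * q1 - p1 * q3) - (p2 - q1) * (p2 * q3 - p3 * q2) =
    - q3 * (E + (p1 * q2 - p2 * q1)).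
Proof.
split; apply/eqP; rewrite -subr_eq0; apply/eqP.
  transitivity (p3 * (E - (q1 ^+ 2 + q2 ^+ 2 + q3 ^+ 2))
    + q3 * (p1 * q1 + p2 * q2 + p3 * q3)); first by rewrite /E; ring.
  by rewrite /E pp_qq subrr pq0; ring.
transitivity (p3 * (p1 * q1 + p2 * q2 + p3 * q3)).
  rewrite /E; ring.
by rewrite pq0 mulr0.
Qed.

(** Stereographic projection gives w = (n_1 + i n_2) / (|p|^2 + n_3), and
    [spinor_normal] turns this quotient into - conj(gamma) / conj(alpha).  If
    alpha were zero, gamma would be zero too, and then n would point to the
    southern pole. *)
Lemma stereo_finite (w : R[i]) : inv_stereo (Some w) = E^-1 *: n ->
  alpha != 0 /\ gamma = - (conjc w * alpha).
Proof.
case: w => x y; rewrite nE => /rowP nw.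
have m0 : 1 + (x ^+ 2 + y ^+ 2) != 0.
  by rewrite gt_eqF// ltr_wpDr// addr_ge0// sqr_ge0.
have := nw 0; have := nw 1; have {nw} := nw 2.
rewrite /= /vec3 !mxE /=.
set m := x ^+ 2 + y ^+ 2 in m0 *.
set n1 := p2 * q3 - _; set n2 := p3 * q1 - _; set n3 := p1 * q2 - _.
have clear_den (s t : R) : (1 + m)^-1 * s = E^-1 * t -> E * s = (1 + m) * t.
  move=> st; transitivity (E * (1 + m) * ((1 + m)^-1 * s)).
    by rewrite mulrA mulfK.
  by rewrite st mulrCA mulrA mulrA mulVf// mul1r.
move=> /clear_den h3 /clear_den h2 /clear_den h1.
have [+ +] := spinor_normal; rewrite -/n1 -/n2 -/n3 => s1 s2.
have E2 : 2 * E != 0 by rewrite mulf_neq0// pnatr_eq0.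
have r1 : (p1 + q2) * x + (p2 - q1) * y = - p3.
  apply: (mulfI E2).
  transitivity ((p1 + q2) * ((1 + m) * n1) + (p2 - q1) * ((1 + m) * n2)).
    by rewrite -h1 -h2; ring.
  transitivity ((1 + m) * ((p1 + q2) * n1 + (p2 - q1) * n2)); first by ring.
  transitivity (- p3 * ((1 + m) * E + (1 + m) * n3)); first by rewrite s1; ring.
  by rewrite -h3; ring.
have r2 : (p1 + q2) * y - (p2 - q1) * x = - q3.
  apply: (mulfI E2).
  transitivity ((p1 + q2) * ((1 + m) * n2) - (p2 - q1) * ((1 + m) * n1)).
    by rewrite -h1 -h2; ring.
  transitivity ((1 + m) * ((p1 + q2) * n2 - (p2 - q1) * n1)); first by ring.
  transitivity (- q3 * ((1 + m) * E + (1 + m) * n3)); first by rewrite s2; ring.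
  by rewrite -h3; ring.
split; last first.
  by apply: complex_eq => /=; rewrite -[LHS]opprK -?r1 -?r2; ring.
apply/eqP => -[a0 b0].
have p30 : p3 = 0 by apply: oppr_inj; rewrite -r1 a0 b0 !mul0r addr0 oppr0.
move: h3.
have -> : n3 = - E.
  have q1E : q1 = p2 by rewrite -[RHS](subrK q1) b0 add0r.
  have q2E : q2 = - p1 by rewrite -[LHS](addKr p1) a0 addr0.
  by rewrite /n3 /E p30 q1E q2E; ring.
move=> /eqP; rewrite -subr_eq0 [X in X == _](_ : _ = 2 * E); last by ring.
by rewrite (negbTE E2).
Qed.

(** If n points to the southern pole, q is p turned by a quarter turn in the
    horizontal plane, the one for which p_1 + q_2 and p_2 - q_1 vanish. *)
Lemma stereo_infinite : inv_stereo (@None R[i] : extC R) = E^-1 *: n -> alpha = 0.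
Proof.
rewrite nE => /rowP nw.
have := nw 0; have := nw 1; have {nw} := nw 2.
rewrite /= /vec3 !mxE /=.
set n1 := p2 * q3 - _; set n2 := p3 * q1 - _; set n3 := p1 * q2 - _.
have clear_den (s t : R) : s = E^-1 * t -> t = E * s by move=> ->; rewrite mulVKf.
move=> /clear_den h3 /clear_den h2 /clear_den h1.
have e1 : E * q1 = n2 * p3 - n3 * p2.
  transitivity (E * q1 - p1 * (p1 * q1 + p2 * q2 + p3 * q3)).
    by rewrite pq0 mulr0 subr0.
  by rewrite /E /n2 /n3; ring.
have e2 : E * q2 = n3 * p1 - n1 * p3.
  transitivity (E * q2 - p2 * (p1 * q1 + p2 * q2 + p3 * q3)).
    by rewrite pq0 mulr0 subr0.
  by rewrite /E /n1 /n3; ring.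
apply: complex_eq => /=; apply: (mulfI E0).
  by rewrite mulrDr e2 h3 h1; ring.
by rewrite mulrBr e1 h3 h2; ring.
Qed.
End conformal_pair.

(** * Gauss map of a minimal conformal frame *)

(** The first order system satisfied by the frame coordinates p and q of X_u and X_v.
    The torsion equations come from [nabla_v X_u = nabla_u X_v], with right-hand
    sides given by the bracket [E_1, E_2] = E_3; the tension equations say that
    nabla_u X_u + nabla_v X_v = 0. *)
Record minimal_frame (R : realType) (U : set R[i])
    (p1 p2 p3 q1 q2 q3 : R[i] -> R^o) : Prop := MinimalFrame {
  frame_smooth_p : [/\ Ck_on 2 U p1, Ck_on 2 U p2 & Ck_on 2 U p3];
  frame_smooth_q : [/\ Ck_on 2 U q1, Ck_on 2 U q2 & Ck_on 2 U q3];
  frame_same_norm : forall z, U z ->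
    p1 z ^+ 2 + p2 z ^+ 2 + p3 z ^+ 2 = q1 z ^+ 2 + q2 z ^+ 2 + q3 z ^+ 2;
  frame_orthogonal : forall z, U z -> p1 z * q1 z + p2 z * q2 z + p3 z * q3 z = 0;
  frame_immersed : forall z, U z -> p1 z ^+ 2 + p2 z ^+ 2 + p3 z ^+ 2 != 0;
  frame_torsion1 : forall z, U z -> pd_v p1 z = pd_u q1 z;
  frame_torsion2 : forall z, U z -> pd_v p2 z = pd_u q2 z;
  frame_torsion3 : forall z, U z ->
    pd_v p3 z = pd_u q3 z + (p1 z * q2 z - p2 z * q1 z);
  frame_tension1 : forall z, U z ->
    pd_u p1 z + pd_v q1 z = - (p2 z * p3 z + q2 z * q3 z);
  frame_tension2 : forall z, U z ->
    pd_u p2 z + pd_v q2 z = p1 z * p3 z + q1 z * q3 z;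
  frame_tension3 : forall z, U z -> pd_u p3 z + pd_v q3 z = 0
}.

Lemma open_Ck_neq0 (R : realType) (U : set R[i]) k (d : R[i] -> R^o) :
  open U -> Ck_on k U d -> open (U `&` [set z | d z != 0]).
Proof.
move=> oU dk; rewrite openE => z [Uz dz].
apply: filterI; first exact: open_nbhs_nbhs.
have dc : d @ nbhs z --> d z by exact: (Ck_continuous dk Uz).
exact: (cvgr_neq0 _ dc dz).
Qed.

Section gauss_equation_frame.
Variables (R : realType) (U : set R[i]) (p1 p2 p3 q1 q2 q3 : R[i] -> R^o).
Hypotheses (oU : open U) (fr : minimal_frame U p1 p2 p3 q1 q2 q3).

Let alpha z : R[i] := (p1 z + q2 z) +i* (p2 z - q1 z).
Let beta z : R[i] := (p1 z - q2 z) -i* (p2 z + q1 z).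
Let gamma z : R[i] := p3 z -i* q3 z.
Let e : R[i] := 0 +i* 8^-1.

Lemma dzbar_alpha z : U z ->
  has_wirtinger alpha z (d_z alpha z)
    (2 * e * (conjc (gamma z) * alpha z + gamma z * conjc (beta z))).
Proof.
move=> Uz; have [P1 P2 P3] := frame_smooth_p fr.
have [Q1 Q2 Q3] := frame_smooth_q fr.
have re_alpha := has_partialsD (Ck_partials P1 Uz) (Ck_partials Q2 Uz).
have im_alpha := has_partialsD (Ck_partials P2 Uz) (has_partialsN (Ck_partials Q1 Uz)).
have W := has_wirtinger_partials (f := alpha) re_alpha im_alpha.
have [d1 d2] := has_wirtinger_d W; rewrite -d1 in W.
apply: has_wirtinger_eq W _ _ => //; rewrite /alpha /beta /gamma /e.
have := frame_tension1 fr Uz; have := frame_tension2 fr Uz.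
have := frame_torsion1 fr Uz; have := frame_torsion2 fr Uz.
rewrite half_complex.
move: (pd_u p1 z) (pd_v p1 z) (pd_u p2 z) (pd_v p2 z) (pd_u q1 z) (pd_v q1 z)
  (pd_u q2 z) (pd_v q2 z) => a b c d a' b' c' d' E1 E2 E3 E4.
move: (p1 z) (p2 z) (p3 z) (q1 z) (q2 z) (q3 z) E3 E4 => x y t x' y' t' E3 E4.
have {}E3 : d' = x * t + x' * t' - c by rewrite -E3; ring.
have {}E4 : b' = - (y * t + y' * t') - a by rewrite -E4; ring.
rewrite E1 E2 E3 E4.
apply: complex_eq => /=; by field.
Qed.

Lemma dzbar_gamma z : U z ->
  has_wirtinger gamma z (d_z gamma z)
    (e * (alpha z * conjc (alpha z) - beta z * conjc (beta z))).
Proof.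
move=> Uz; have [P1 P2 P3] := frame_smooth_p fr.
have [Q1 Q2 Q3] := frame_smooth_q fr.
have W := has_wirtinger_partials (f := gamma) (Ck_partials P3 Uz) (has_partialsN (Ck_partials Q3 Uz)).
have [d1 d2] := has_wirtinger_d W; rewrite -d1 in W.
apply: has_wirtinger_eq W _ _ => //; rewrite /alpha /beta /gamma /e.
have := frame_tension3 fr Uz; have := frame_torsion3 fr Uz.
rewrite half_complex.
move: (pd_u p3 z) (pd_v p3 z) (pd_u q3 z) (pd_v q3 z) => a b c d E1 E2.
move: (p1 z) (p2 z) (p3 z) (q1 z) (q2 z) (q3 z) E1 => x y t x' y' t' E1.
have {}E2 : d = - a by rewrite -[d](addKr a) E2 addr0.
rewrite E1 E2.
apply: complex_eq => /=; by field.
Qed.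

Variable h : R[i] -> extC R.
Hypothesis hn : forall z, U z ->
  inv_stereo (h z) = (p1 z ^+ 2 + p2 z ^+ 2 + p3 z ^+ 2)^-1 *:
    cross3 (vec3 (p1 z) (p2 z) (p3 z)) (vec3 (q1 z) (q2 z) (q3 z)).

Let f z := finite_part (h z).

Let alphaP z : U z -> alpha z != 0 <-> h z <> None.
Proof.
move=> Uz; have := hn Uz; case: (h z) => [w|] hz; split => //.
  by have [] := stereo_finite (frame_same_norm fr Uz) (frame_orthogonal fr Uz)
    (frame_immersed fr Uz) hz.
have := stereo_infinite (frame_orthogonal fr Uz) (frame_immersed fr Uz) hz.
by rewrite /alpha => ->; rewrite eqxx.
Qed.

Let gammaE z : U z -> h z <> None -> gamma z = - (conjc (f z) * alpha z).
Proof.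
move=> Uz; have := hn Uz; rewrite /f; case: (h z) => [w|] // hz _.
by have [] := stereo_finite (frame_same_norm fr Uz) (frame_orthogonal fr Uz)
    (frame_immersed fr Uz) hz.
Qed.

Let d : R[i] -> R^o := fun z =>
  (p1 z + q2 z) * (p1 z + q2 z) + (p2 z + - q1 z) * (p2 z + - q1 z).

Let dP z : d z != 0 <-> alpha z != 0.
Proof.
rewrite /d /alpha; split; apply: contraNN => /eqP.
  by case=> -> ->; rewrite !mul0r addr0.
move=> /eqP; rewrite -!expr2 paddr_eq0 ?sqr_ge0// !sqrf_eq0.
by rewrite eq_complex.
Qed.

Let d_Ck : Ck_on 2 U d.
Proof.
have [P1 P2 P3] := frame_smooth_p fr.
have [Q1 Q2 Q3] := frame_smooth_q fr.
have aCk := CkD oU P1 Q2; have bCk := CkD oU P2 (CkN oU Q1).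
exact: (CkD oU (CkM oU aCk aCk) (CkM oU bCk bCk)).
Qed.

Let V := U `&` [set z | d z != 0].

Let oV : open V. Proof. exact: open_Ck_neq0 d_Ck. Qed.

Let VP z : V z <-> U z /\ h z <> None.
Proof. by split=> -[Uz] /=; [move/dP/(alphaP Uz)|move/(alphaP Uz)/dP]. Qed.

(** The value of [h] is finite exactly where the smooth function |alpha|^2 does not
    vanish. *)
Lemma open_finite : open (U `&` [set z | h z <> None]).
Proof. by rewrite (_ : _ `&` _ = V)//; apply/seteqP; split=> z /VP. Qed.

Let f_Ck : Ck_on 2 V (re_part f : _ -> R^o) /\ Ck_on 2 V (im_part f : _ -> R^o).
Proof.
have VU : V `<=` U by move=> z [].
have [P1 P2 P3] := frame_smooth_p fr.
have [Q1 Q2 Q3] := frame_smooth_q fr.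
have {}P1 := Ck_sub VU P1; have {}P2 := Ck_sub VU P2; have {}P3 := Ck_sub VU P3.
have {}Q1 := Ck_sub VU Q1; have {}Q2 := Ck_sub VU Q2; have {}Q3 := Ck_sub VU Q3.
have dV : Ck_on 2 V (fun z => (d z)^-1 : R^o).
  by apply: (CkV oV _ (Ck_sub VU d_Ck)) => z [].
have a_Ck := CkD oV P1 Q2; have b_Ck := CkD oV P2 (CkN oV Q1).
(* Real and imaginary part of - conj(gamma) / conj(alpha), with [d] = |alpha|^2. *)
have fE z : V z ->
    (- ((p1 z + q2 z) * p3 z) + (p2 z + - q1 z) * q3 z) * (d z)^-1 = complex.Re (f z) /\
    (- ((p2 z + - q1 z) * p3 z) + - ((p1 z + q2 z) * q3 z)) * (d z)^-1 = complex.Im (f z).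
  move=> Vz; have [Uz hz] := (VP z).1 Vz; have := gammaE Uz hz.
  have : d z != 0 by case: Vz.
  rewrite /d /gamma /alpha; case: (f z) => x y /= d0 [-> /eqP].
  rewrite eqr_oppLR => /eqP ->.
  by split; field; rewrite d0.
split.
- apply: Ck_ext oV (fun z Vz => (fE z Vz).1) _.
  exact: (CkM oV (CkD oV (CkN oV (CkM oV a_Ck P3)) (CkM oV b_Ck Q3)) dV).
- apply: Ck_ext oV (fun z Vz => (fE z Vz).2) _.
  exact: (CkM oV (CkD oV (CkN oV (CkM oV b_Ck P3)) (CkN oV (CkM oV a_Ck Q3))) dV).
Qed.

(** Differentiating gamma = - conj(f) alpha in zbar and comparing with
    [dzbar_gamma] yields d_z f, which is what [gauss_equation_of_spinor] needs. *)
Lemma gauss_equation_frame z : U z -> h z <> None -> C2_near f z /\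
  (1 - `|f z| ^+ 2) * d_zbar (d_z f) z
    + 2 * conjc (f z) * d_z f z * d_zbar f z = 0.
Proof.
move=> Uz0 hz0; have [fre fim] := f_Ck.
have Vz0 : V z by apply/VP.
split; first by exists V; split.
have ee : conjc e = - e by apply: complex_eq; rewrite /= ?oppr0.
have betaE w : V w -> beta w = - (conjc (f w) * conjc (f w) * alpha w).
  move=> Vw; have [Uw hw] := (VP w).1 Vw.
  apply: (mulfI ((alphaP Uw).2 hw)).
  apply: etrans (spinor_relation (frame_same_norm fr Uw) (frame_orthogonal fr Uw)) _.
  by rewrite -/(gamma w) gammaE//; ring.
have dbar_alpha w : V w -> has_wirtinger alpha w (d_z alpha w)
   (- (2 * e) * f w * (alpha w * conjc (alpha w)) * (1 - f w * conjc (f w))).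
  move=> Vw; have [Uw hw] := (VP w).1 Vw.
  apply: has_wirtinger_eq (dzbar_alpha Uw) _ _ => //.
  rewrite betaE// gammaE// !(conjcN, conjcM, conjcK).
  by move: (f w) (conjc (f w)) (alpha w) (conjc (alpha w)) => *; ring.
apply: (gauss_equation_of_spinor oV Vz0 ee fre fim _ (dbar_alpha z Vz0)) => w Vw.
have [Uw hw] := (VP w).1 Vw.
have fw := has_wirtinger_Ck fre fim Vw.
have W := has_wirtingerM (has_wirtinger_cst (-1) w)
  (has_wirtingerM (has_wirtinger_conj fw) (dbar_alpha w Vw)).
have [|_ +] := has_wirtinger_d (has_wirtinger_ext (g := gamma) oV Vw _ W).
  by move=> t Vt; have [Ut ht] := (VP t).1 Vt; rewrite gammaE// mulN1r.
have [_ ->] := has_wirtinger_d (dzbar_gamma Uw).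
rewrite betaE// !(conjcN, conjcM (conjc (f w) * _), conjcM (conjc (f w)), conjcK).
move=> E; apply: (can_inj (@conjcK R)); apply: (mulfI ((alphaP Uw).2 hw)).
move: E; move: (conjc (d_z f w)) => dF.
rewrite expr2 !(conjcM, conjcB, conjcK, conjc1) ee.
move: (f w) (conjc (f w)) (alpha w) (conjc (alpha w)) => F F' a a' E.
transitivity (- (0 * (F' * a) + -1 * (dF * a +
  F' * (- (2 * e) * F * (a * a') * (1 - F * F'))))
  - F' * (- (2 * e) * F * (a * a') * (1 - F * F'))); first by ring.
by rewrite -E; ring.
Qed.
End gauss_equation_frame.

(** * Metric and Levi-Civita connection of Nil_3 *)

Section nil_geometry.
Variable R : realType.
Implicit Types x a b c v : 'rV[R]_3.

Lemma vec3_eta (a : 'rV[R]_3) : a = vec3 (x1 a) (x2 a) (x3 a).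
Proof.
apply/rowP => -[[|[|[|//]]] ltk]; rewrite /vec3 mxE /=; congr (a _ _);
  exact: val_inj.
Qed.

Lemma x1_vec3 (a b c : R) : x1 (vec3 a b c) = a.
Proof. by rewrite /x1 /vec3 mxE. Qed.
Lemma x2_vec3 (a b c : R) : x2 (vec3 a b c) = b.
Proof. by rewrite /x2 /vec3 mxE. Qed.
Lemma x3_vec3 (a b c : R) : x3 (vec3 a b c) = c.
Proof. by rewrite /x3 /vec3 mxE. Qed.
Definition vec3E := (x1_vec3, x2_vec3, x3_vec3).

Lemma vec3Z (k a b c : R) : k *: vec3 a b c = vec3 (k * a) (k * b) (k * c).
Proof. by rewrite [LHS]vec3_eta /x1 /x2 /x3 /vec3 !mxE. Qed.

Lemma frame_coordE x a : frame_coord x a = vec3 (x1 a) (x2 a) (contact x a).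
Proof.
apply/rowP => -[[|[|[|//]]] ltk]; rewrite !mxE /= /frame /metric /contact /=
  !vec3E; by field.
Qed.

Lemma of_frameE x c : of_frame x c =
  vec3 (x1 c) (x2 c) (x3 c - 2^-1 * (x2 x * x1 c - x1 x * x2 c)).
Proof.
have i2 : lift ord0 (ord0 : 'I_2) = 1 :> 'I_3 by exact: val_inj.
have i3 : lift ord0 (lift ord0 (ord0 : 'I_1)) = 2 :> 'I_3 by exact: val_inj.
rewrite /of_frame !big_ord_recl big_ord0 i2 i3 /frame /= !vec3Z.
by rewrite [LHS]vec3_eta; congr vec3; rewrite /x1 /x2 /x3 /vec3 !mxE /=; field.
Qed.

Lemma of_frameK x c : frame_coord x (of_frame x c) = c.
Proof.
rewrite frame_coordE [RHS]vec3_eta of_frameE /contact !vec3E; congr vec3; ring.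
Qed.

Lemma contactD x a b : contact x (a + b) = contact x a + contact x b.
Proof. by rewrite /contact /x1 /x2 /x3 !mxE; ring. Qed.

Lemma contactZ x k a : contact x (k *: a) = k * contact x a.
Proof. by rewrite /contact /x1 /x2 /x3 !mxE; ring. Qed.

Lemma metricDl x a b c : metric x (a + b) c = metric x a c + metric x b c.
Proof. by rewrite /metric contactD /x1 /x2 !mxE; ring. Qed.

Lemma metricZl x k a c : metric x (k *: a) c = k * metric x a c.
Proof. by rewrite /metric contactZ /x1 /x2 !mxE; ring. Qed.

Lemma metricC x a b : metric x a b = metric x b a.
Proof. by rewrite /metric; ring. Qed.

Lemma metric_mxE x a b : metric x a b = \sum_i \sum_j a 0 i * metric_mx x i j * b 0 j.
Proof.
have aE (v : 'rV[R]_3) : v = \sum_i v 0 i *: basis3 R i by exact: row_sum_delta.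
have mD (c : 'I_3 -> 'rV[R]_3) (d : 'rV[R]_3) (I : 'I_3 -> R) : metric x (\sum_(i : 'I_3) I i *: c i) d = \sum_i I i * metric x (c i) d.
  elim/big_ind2 : _ => [|? ? ? ? <- <-|i _]; rewrite ?metricDl ?metricZl//.
  by rewrite /metric /contact /x1 /x2 /x3 !mxE; ring.
rewrite {1}(aE a) mD; apply: eq_bigr => i _.
rewrite {1}(aE b) metricC mD mulr_sumr; apply: eq_bigr => j _.
by rewrite mxE metricC; ring.
Qed.

(** The metric is a sum of three squares of independent linear forms, hence
    positive definite. *)
Lemma metric_mx_unit x : metric_mx x \in unitmx.
Proof.
rewrite -row_free_unit -kermx_eq0; apply/rowV0P => v /sub_kermxP vg.
have : metric x v v = 0.
  rewrite metric_mxE exchange_big big1// => j _.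
  by rewrite -mulr_suml; move/rowP/(_ j): vg; rewrite !mxE => ->; rewrite mul0r.
rewrite /metric -!expr2 => /eqP; rewrite paddr_eq0 ?addr_ge0 ?sqr_ge0//.
rewrite paddr_eq0 ?sqr_ge0// !sqrf_eq0 => /andP[/andP[/eqP v1 /eqP v2]].
rewrite /contact v1 v2 !mulr0 subrr mulr0 add0r => /eqP v3.
by rewrite [LHS]vec3_eta v1 v2 v3 -[RHS](scale0r (vec3 0 0 0)) vec3Z !mul0r.
Qed.

(** The contact form at [y] applied to a fixed vector [b] is affine in [y]; this is
    its derivative in the direction [v].  It is skew in [v] and [b]. *)
Definition contact_slope v b : R := 2^-1 * (x2 v * x1 b - x1 v * x2 b).

Lemma is_derive_coord x v i :
  is_derive x v (fun y : 'rV[R]_3 => y 0 i : R^o) (v 0 i).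
Proof.
have id_d : derivable (@id 'rV[R]_3) x v by exact: derivable_id.
have /derivable_mxP/(_ 0 i) d_i := id_d.
apply: DeriveDef => //.
by have := derive_mx id_d; rewrite derive_id => /rowP/(_ i); rewrite mxE.
Qed.

Lemma is_derive_contact x v b :
  is_derive x v (fun y => contact y b : R^o) (contact_slope v b).
Proof.
have d1 := is_deriveZ (x1 b) (is_derive_coord x v 1).
have d2 := is_deriveZ (x2 b) (is_derive_coord x v 0).
have d3 := is_derive_cst (x3 b : R^o) x v.
have := is_deriveD (is_deriveZ 2^-1 (is_deriveB d1 d2)) d3.
have -> : 2^-1 *: ((x1 b *: (fun y : 'rV[R]_3 => y 0 1 : R^o)) -
    (x2 b *: (fun y : 'rV[R]_3 => y 0 0 : R^o))) + cst (x3 b : R^o) =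
    fun y => contact y b.
  apply/funext => y; rewrite /contact /x1 /x2 !fctE /GRing.scale /=; ring.
move=> dc; apply: is_derive_eq dc _.
rewrite /contact_slope /x1 /x2 /GRing.scale /=; ring.
Qed.

Lemma is_derive_metric x v b c :
  is_derive x v (fun y => metric y b c : R^o)
    (contact_slope v b * contact x c + contact x b * contact_slope v c).
Proof.
have d0 := is_derive_cst (x1 b * x1 c + x2 b * x2 c : R^o) x v.
have := is_deriveD d0 (is_deriveM (is_derive_contact x v b) (is_derive_contact x v c)).
move=> dm; apply: is_derive_eq dm _.
by rewrite add0r addrC /GRing.scale /=; congr (_ + _); rewrite mulrC.
Qed.

Lemma d_metricE i j k x : d_metric i j k x =
  contact_slope (basis3 R i) (basis3 R j) * contact x (basis3 R k)
  + contact x (basis3 R j) * contact_slope (basis3 R i) (basis3 R k).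
Proof.
rewrite /d_metric.
have -> : (fun y => metric_mx y j k : R^o) =
    fun y => metric y (basis3 R j) (basis3 R k).
  by apply/funext => y; rewrite mxE.
by have dm := is_derive_metric x (basis3 R i) (basis3 R j) (basis3 R k); rewrite derive_val.
Qed.

(** Lowering the index cancels the inverse metric in the Christoffel symbols and
    leaves derivatives of the metric.  In the frame the formula reads
    nabla_a a = (a_2 a_3, - a_1 a_3, 0) for a field with constant frame coordinates,
    and this diagonal part is all that the tension field involves. *)
Lemma metric_connection x a c :
  metric x (connection x a a) c =
  contact x a * (x2 a * x1 c - x1 a * x2 c).
Proof.
(* The Christoffel symbols with lowered index, contracted with [a] twice. *)
pose w : 'rV[R]_3 := \row_l \sum_i \sum_j
  (d_metric i j l x + d_metric j i l x - d_metric l i j x) * a 0 i * a 0 j.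
have connE : (connection x a a)^T = 2^-1 *: (invmx (metric_mx x) *m w^T).
  apply/colP => k; rewrite !mxE /christoffel.
  under eq_bigr => i _.
    under eq_bigr => j _ do rewrite -mulrA -mulrA mulr_suml.
    over.
  under eq_bigr => i _ do rewrite -mulr_sumr.
  rewrite -mulr_sumr; congr (_ * _).
  under eq_bigr => i _ do rewrite exchange_big /=.
  rewrite exchange_big /=; apply: eq_bigr => l _.
  rewrite !mxE mulr_sumr; apply: eq_bigr => i _.
  rewrite mulr_sumr; apply: eq_bigr => j _; ring.
rewrite metricC metric_mxE.
have -> : \sum_i \sum_j c 0 i * metric_mx x i j * connection x a a 0 j =
    2^-1 * \sum_l c 0 l * w 0 l.
  have wE : w^T = 2 *: (metric_mx x *m (connection x a a)^T).
    rewrite connE -scalemxAr mulKVmx ?metric_mx_unit// scalerA divff ?pnatr_eq0//.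
    by rewrite scale1r.
  rewrite mulr_sumr; apply: eq_bigr => i _.
  move/colP/(_ i): wE; rewrite mxE [RHS]mxE [X in 2 * X]mxE => ->.
  rewrite mulrCA mulKf ?pnatr_eq0// mulr_sumr.
  by apply: eq_bigr => j _; rewrite [(connection x a a)^T j 0]mxE mulrA.
rewrite /w; under eq_bigr do rewrite mxE.
under eq_bigr => l _.
  under eq_bigr => i _. under eq_bigr => j _ do rewrite !d_metricE.
  over. over.
have i1 : ord0 = 0 :> 'I_3 by exact: val_inj.
have i2 : lift ord0 (ord0 : 'I_2) = 1 :> 'I_3 by exact: val_inj.
have i3 : lift ord0 (lift ord0 (ord0 : 'I_1)) = 2 :> 'I_3 by exact: val_inj.
rewrite !big_ord_recl !big_ord0 i1 i2 i3.
rewrite /contact_slope /contact /basis3 /x1 /x2 /x3 !mxE /=.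
move: (a 0 0) (a 0 1) (a 0 2) (c 0 0) (c 0 1) (c 0 2) (x 0 0) (x 0 1)
  => a1 a2 a3 c1 c2 c3 y1 y2.
by field.
Qed.

End nil_geometry.

(** * Unit normal and mean curvature of a conformal pair of vectors *)

Section conformal_pair_of_vectors.
Variables (R : realType) (x a b : 'rV[R]_3).
Let p3 := contact x a.
Let q3 := contact x b.
Let E := x1 a ^+ 2 + x2 a ^+ 2 + p3 ^+ 2.

Lemma metric_self : metric x a a = E.
Proof. by rewrite /E /metric !expr2. Qed.

Lemma row_free_energy : row_free (col_mx a b) -> E != 0.
Proof.
move=> free; apply/eqP => E0.
have a0 : a = 0.
  have E_ge0 (s t r : R) : s ^+ 2 + t ^+ 2 + r ^+ 2 = 0 -> [/\ s = 0, t = 0 & r = 0].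
    move=> /eqP; rewrite paddr_eq0 ?addr_ge0 ?sqr_ge0//.
    rewrite paddr_eq0 ?sqr_ge0// !sqrf_eq0.
    by move=> /andP[/andP[/eqP ? /eqP ?] /eqP ?].
  have [a1 a2 a3] := E_ge0 _ _ _ E0.
  move: a3; rewrite /p3 /contact a1 a2 !mulr0 subrr mulr0 add0r => a3.
  by rewrite [LHS]vec3_eta a1 a2 a3 -[RHS](scale0r (vec3 0 0 0)) vec3Z !mul0r.
move: free; rewrite /row_free a0 => /eqP rk.
have : (\rank (col_mx (0 : 'rV[R]_3) b) <= 1)%N.
  by rewrite -addsmxE adds0mx; exact: rank_leq_row.
by rewrite rk.
Qed.

Hypothesis same_norm : metric x a a = metric x b b.
Hypothesis orthogonal : metric x a b = 0.
Hypothesis E0 : E != 0.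

Let n := (Num.sqrt (metric x (cross x a b) (cross x a b)))^-1 *: cross x a b.

(** The coordinates of a vector product in an orthonormal frame; for a conformal pair
    the product has length |a|^2, by the identity of Lagrange. *)
Lemma frame_coord_unit_cross :
  frame_coord x n = E^-1 *: cross3 (vec3 (x1 a) (x2 a) p3) (vec3 (x1 b) (x2 b) q3).
Proof.
have cE : frame_coord x (cross x a b) =
    cross3 (vec3 (x1 a) (x2 a) p3) (vec3 (x1 b) (x2 b) q3).
  by rewrite /cross of_frameK !frame_coordE.
have fZ k v : frame_coord x (k *: v) = k *: frame_coord x v.
  by rewrite !frame_coordE vec3Z contactZ /x1 /x2 !mxE.
rewrite fZ cE; congr (_^-1 *: _).
have -> : metric x (cross x a b) (cross x a b) = E ^+ 2.
  move: cE; rewrite frame_coordE /cross3 !vec3E => cE.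
  have := congr1 (@x1 R) cE; have := congr1 (@x2 R) cE; have := congr1 (@x3 R) cE.
  rewrite !vec3E {1}/metric => -> -> ->.
  move: same_norm orthogonal; rewrite /E /metric -/p3 -/q3.
  move: (x1 a) (x2 a) p3 (x1 b) (x2 b) q3 => s t r s' t' r' N O.
  transitivity ((s ^+ 2 + t ^+ 2 + r ^+ 2) * (s' * s' + t' * t' + r' * r')
     - (s * s' + t * t' + r * r') ^+ 2); first by ring.
  by rewrite -N O; ring.
by rewrite sqrtr_sqr ger0_norm// !addr_ge0// sqr_ge0.
Qed.

(** The hypothesis is the vanishing of the mean curvature, with [auu] and [bvv] the
    second derivatives of the immersion.  For a conformal pair the mixed coefficient
    drops out and the formula reduces to the normal component of
    nabla_u X_u + nabla_v X_v. *)
Lemma normal_tension (auu bvv m : 'rV[R]_3) :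
  let N v := metric x v n in
  (N (auu + connection x a a) * metric x b b - 2 * N m * metric x a b
    + N (bvv + connection x b b) * metric x a a)
   / (2 * (metric x a a * metric x b b - metric x a b ^+ 2)) = 0 ->
  (x1 auu + x1 bvv + (x2 a * p3 + x2 b * q3)) * (x2 a * q3 - p3 * x2 b)
  + (x2 auu + x2 bvv - (x1 a * p3 + x1 b * q3)) * (p3 * x1 b - x1 a * q3)
  + (contact x auu + contact x bvv) * (x1 a * x2 b - x2 a * x1 b) = 0.
Proof.
rewrite /= orthogonal -same_norm metric_self !metricDl !metric_connection.
rewrite mulr0 subr0 expr0n /= subr0 -mulrDl => /eqP; rewrite mulf_eq0 invr_eq0.
rewrite !mulf_eq0 (negbTE E0) pnatr_eq0 /= !orbF => /eqP.
have := frame_coord_unit_cross; rewrite frame_coordE /cross3 !vec3E vec3Z => nE.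
have := congr1 (@x1 R) nE; have := congr1 (@x2 R) nE; have := congr1 (@x3 R) nE.
rewrite !vec3E /metric => -> -> -> /(congr1 ( *%R E)).
rewrite mulr0 => <-; rewrite -/p3 -/q3.
move: E0; move: E => e e0.
move: (x1 a) (x2 a) p3 (x1 b) (x2 b) q3 => *.
by field.
Qed.

End conformal_pair_of_vectors.

(** * The frame of a conformal minimal immersion *)

(** Cramer's rule for the basis p, q, p x q, of determinant |p x q|^2 = |p|^4. *)
Lemma orthogonal_to_basis (R : realType) (p1 p2 p3 q1 q2 q3 t1 t2 t3 : R) :
  p1 ^+ 2 + p2 ^+ 2 + p3 ^+ 2 = q1 ^+ 2 + q2 ^+ 2 + q3 ^+ 2 ->
  p1 * q1 + p2 * q2 + p3 * q3 = 0 ->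
  p1 ^+ 2 + p2 ^+ 2 + p3 ^+ 2 != 0 ->
  p1 * t1 + p2 * t2 + p3 * t3 = 0 -> q1 * t1 + q2 * t2 + q3 * t3 = 0 ->
  t1 * (p2 * q3 - p3 * q2) + t2 * (p3 * q1 - p1 * q3) + t3 * (p1 * q2 - p2 * q1) = 0 ->
  [/\ t1 = 0, t2 = 0 & t3 = 0].
Proof.
move=> N O E0 tp tq tn.
(* Lagrange's identity. *)
have nn0 : (p1 ^+ 2 + p2 ^+ 2 + p3 ^+ 2) ^+ 2 =
    (p2 * q3 - p3 * q2) ^+ 2 + (p3 * q1 - p1 * q3) ^+ 2 + (p1 * q2 - p2 * q1) ^+ 2.
  transitivity ((p1 ^+ 2 + p2 ^+ 2 + p3 ^+ 2) * (q1 ^+ 2 + q2 ^+ 2 + q3 ^+ 2)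
     - (p1 * q1 + p2 * q2 + p3 * q3) ^+ 2); first by rewrite -N O; ring.
  by ring.
have EE0 := expf_neq0 2 E0.
set n1 := p2 * q3 - p3 * q2 in tn nn0; set n2 := p3 * q1 - p1 * q3 in tn nn0.
set n3 := p1 * q2 - p2 * q1 in tn nn0.
have cramer (t r1 r2 r3 : R) :
  t * (n1 ^+ 2 + n2 ^+ 2 + n3 ^+ 2) =
    (p1 * t1 + p2 * t2 + p3 * t3) * r1 + (q1 * t1 + q2 * t2 + q3 * t3) * r2
    + (t1 * n1 + t2 * n2 + t3 * n3) * r3 -> t = 0.
  by rewrite tp tq tn -nn0 !mul0r !addr0 => /eqP; rewrite mulf_eq0 (negbTE EE0) orbF => /eqP.
split.
- by apply: (cramer _ (q2 * n3 - q3 * n2) (n2 * p3 - n3 * p2) n1); rewrite /n1 /n2 /n3; ring.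
- by apply: (cramer _ (q3 * n1 - q1 * n3) (n3 * p1 - n1 * p3) n2); rewrite /n1 /n2 /n3; ring.
- by apply: (cramer _ (q1 * n2 - q2 * n1) (n1 * p2 - n2 * p1) n3); rewrite /n1 /n2 /n3; ring.
Qed.

Section fields_along.
Variable R : realType.
Implicit Types (U : set R[i]) (Y W : R[i] -> 'rV[R]_3) (z : R[i]).

Lemma has_partials_coord Y z a b i : has_partials Y z a b ->
  has_partials (fun w => Y w 0 i : R^o) z (a 0 i) (b 0 i).
Proof.
move=> [ya yb]; split.
- have [dy <-] := ya; rewrite derive_mx//.
  by apply: DeriveDef; [exact: (derivable_mxP _ _ _).1|rewrite mxE].
- have [dy <-] := yb; rewrite derive_mx//.
  by apply: DeriveDef; [exact: (derivable_mxP _ _ _).1|rewrite mxE].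
Qed.

Lemma Ck_coord k U Y i : open U -> Ck_on k U Y ->
  Ck_on k U (fun w => Y w 0 i : R^o).
Proof.
move=> oU; elim: k Y => [|k IH] Y Yk.
all: have cY z (Uz : U z) : {for z, continuous (fun w => Y w 0 i : R^o)} by
  exact: (continuous_comp (Ck_continuous Yk Uz) (@coord_continuous R 1 3 0 i (Y z))).
  by split.
apply: (CkS oU cY _ (IH _ (Ck_pd_u Yk)) (IH _ (Ck_pd_v Yk))) => z Uz.
exact: has_partials_coord (Ck_partials Yk Uz).
Qed.

Lemma has_partials_x1 Y z a b : has_partials Y z a b ->
  has_partials (fun w => x1 (Y w) : R^o) z (x1 a) (x1 b).
Proof. exact: has_partials_coord. Qed.

Lemma has_partials_x2 Y z a b : has_partials Y z a b ->
  has_partials (fun w => x2 (Y w) : R^o) z (x2 a) (x2 b).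
Proof. exact: has_partials_coord. Qed.

Lemma Ck_x1 k U Y : open U -> Ck_on k U Y -> Ck_on k U (fun w => x1 (Y w) : R^o).
Proof. exact: Ck_coord. Qed.

Lemma Ck_x2 k U Y : open U -> Ck_on k U Y -> Ck_on k U (fun w => x2 (Y w) : R^o).
Proof. exact: Ck_coord. Qed.

Lemma schwarz_vec U Y z : open U -> Ck_on 2 U Y -> U z ->
  pd_v (pd_u Y) z = pd_u (pd_v Y) z.
Proof.
move=> oU Y2 Uz; apply/rowP => i.
have Yi2 := Ck_coord i oU Y2.
have pdE w : U w -> pd_u Y w 0 i = pd_u (fun w => Y w 0 i : R^o) w /\
    pd_v Y w 0 i = pd_v (fun w => Y w 0 i : R^o) w.
  by move=> Uw; have [-> ->] := has_partials_pd (has_partials_coord i (Ck_partials Y2 Uw)).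
have /has_partials_pd[_ uv] := has_partials_ext oU Uz (fun w Uw => (pdE w Uw).1)
  (has_partials_coord i (Ck_partials (Ck_pd_u Y2) Uz)).
have /has_partials_pd[vu _] := has_partials_ext oU Uz (fun w Uw => (pdE w Uw).2)
  (has_partials_coord i (Ck_partials (Ck_pd_v Y2) Uz)).
exact: etrans (esym uv) (etrans (schwarz oU Yi2 Uz) vu).
Qed.

Lemma has_partials_contact Y W z a b c d :
  has_partials Y z a b -> has_partials W z c d ->
  has_partials (fun w => contact (Y w) (W w) : R^o) z
    (contact_slope a (W z) + contact (Y z) c)
    (contact_slope b (W z) + contact (Y z) d).
Proof.
move=> Yab Wcd.
have Yi i := has_partials_coord i Yab; have Wi i := has_partials_coord i Wcd.
have H := has_partialsD (has_partialsM (has_partials_cst (2^-1 : R^o) z)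
  (has_partialsD (has_partialsM (Yi 1) (Wi 0))
    (has_partialsN (has_partialsM (Yi 0) (Wi 1))))) (Wi 2).
apply: has_partials_eq H _ _; rewrite /contact_slope /contact /x1 /x2 /x3; ring.
Qed.

Lemma Ck_contact k U Y W : open U -> Ck_on k U Y -> Ck_on k U W ->
  Ck_on k U (fun w => contact (Y w) (W w) : R^o).
Proof.
move=> oU Yk Wk.
have Yi i := Ck_coord i oU Yk; have Wi i := Ck_coord i oU Wk.
exact: (CkD oU (CkM oU (Ck_cst k (2^-1 : R^o) oU) (CkD oU (CkM oU (Yi 1) (Wi 0))
    (CkN oU (CkM oU (Yi 0) (Wi 1))))) (Wi 2)).
Qed.

End fields_along.

(** The last hypothesis is orthogonality of the tension field to the normal.
    Orthogonality to p and q follows by differentiating |p|^2 = |q|^2 and p . q = 0: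
    the u-derivative of the first and the v-derivative of the second give the
    product with p, the other two the product with q, once p_v is replaced by q_u
    through the torsion equations. *)
Lemma tension_vanishes (R : realType) (U : set R[i])
    (p1 p2 p3 q1 q2 q3 : R[i] -> R^o) z
    (p1u p2u p3u q1u q2u q3u p1v p2v p3v q1v q2v q3v : R) :
  open U -> U z ->
  has_partials p1 z p1u p1v -> has_partials p2 z p2u p2v ->
  has_partials p3 z p3u p3v -> has_partials q1 z q1u q1v ->
  has_partials q2 z q2u q2v -> has_partials q3 z q3u q3v ->
  (forall w, U w ->
    p1 w ^+ 2 + p2 w ^+ 2 + p3 w ^+ 2 = q1 w ^+ 2 + q2 w ^+ 2 + q3 w ^+ 2) ->
  (forall w, U w -> p1 w * q1 w + p2 w * q2 w + p3 w * q3 w = 0) ->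
  p1 z ^+ 2 + p2 z ^+ 2 + p3 z ^+ 2 != 0 ->
  p1v = q1u -> p2v = q2u -> p3v = q3u + (p1 z * q2 z - p2 z * q1 z) ->
  (p1u + q1v + (p2 z * p3 z + q2 z * q3 z)) * (p2 z * q3 z - p3 z * q2 z)
  + (p2u + q2v - (p1 z * p3 z + q1 z * q3 z)) * (p3 z * q1 z - p1 z * q3 z)
  + (p3u + q3v) * (p1 z * q2 z - p2 z * q1 z) = 0 ->
  [/\ p1u + q1v + (p2 z * p3 z + q2 z * q3 z) = 0,
      p2u + q2v - (p1 z * p3 z + q1 z * q3 z) = 0 & p3u + q3v = 0].
Proof.
move=> oU Uz P1 P2 P3 Q1 Q2 Q3 N O E0 t1 t2 t3 Tn.
have NE (f g h : R[i] -> R^o) w : f w ^+ 2 + g w ^+ 2 + h w ^+ 2 =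
    f w * f w + g w * g w + h w * h w :> R by rewrite !expr2.
have sq f (a b : R) (F : has_partials f z a b) := has_partialsM F F.
have PP := has_partialsD (has_partialsD (sq _ _ _ P1) (sq _ _ _ P2)) (sq _ _ _ P3).
have QQ := has_partialsD (has_partialsD (sq _ _ _ Q1) (sq _ _ _ Q2)) (sq _ _ _ Q3).
have PQ := has_partialsD (has_partialsD (has_partialsM P1 Q1) (has_partialsM P2 Q2))
  (has_partialsM P3 Q3).
have [Nu Nv] := has_partials_inj oU Uz
  (fun w Uw => etrans (etrans (esym (NE p1 p2 p3 w)) (N w Uw)) (NE q1 q2 q3 w)) PP QQ.
have [Ou Ov] := has_partials_inj oU Uz O PQ (has_partials_cst (0 : R^o) z).
move: E0 Tn Nu Nv Ou Ov {P1 P2 P3 Q1 Q2 Q3 PP QQ PQ}.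
move: (N z Uz) (O z Uz); rewrite t1 t2 t3.
move: (p1 z) (p2 z) (p3 z) (q1 z) (q2 z) (q3 z) => a b c a' b' c' Nz Oz E0 Tn Nu Nv Ou Ov.
apply: (orthogonal_to_basis Nz Oz E0 _ _ Tn).
all: by lra.
Qed.

Lemma contact_slope_self (R : realType) (a : 'rV[R]_3) (r : R) :
  contact_slope a a + r = r.
Proof. by rewrite /contact_slope; ring. Qed.

Lemma contact_slope_swap (R : realType) (a b : 'rV[R]_3) (r : R) :
  contact_slope b a + r = contact_slope a b + r + (x1 a * x2 b - x2 a * x1 b).
Proof. by rewrite /contact_slope; field. Qed.

Lemma metric_self_eq (R : realType) (x a b : 'rV[R]_3) :
  metric x a a = metric x b b ->
  x1 a ^+ 2 + x2 a ^+ 2 + contact x a ^+ 2 = x1 b ^+ 2 + x2 b ^+ 2 + contact x b ^+ 2.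
Proof. by rewrite !metric_self. Qed.

Lemma minimal_frame_immersion (R : realType) (U : set R[i]) (Y : R[i] -> 'rV[R]_3) :
  open U -> smooth_on U Y ->
  (forall z, U z ->
    metric (Y z) (pd_u Y z) (pd_u Y z) = metric (Y z) (pd_v Y z) (pd_v Y z) /\
    metric (Y z) (pd_u Y z) (pd_v Y z) = 0) ->
  (forall z, U z -> row_free (col_mx (pd_u Y z) (pd_v Y z))) ->
  (forall z, U z -> mean_curvature Y z = 0) ->
  minimal_frame U
    (fun z => x1 (pd_u Y z)) (fun z => x2 (pd_u Y z)) (fun z => contact (Y z) (pd_u Y z))
    (fun z => x1 (pd_v Y z)) (fun z => x2 (pd_v Y z)) (fun z => contact (Y z) (pd_v Y z)).
Proof.
move=> oU Ys conf free H0.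
have eq_opp (s t : R) : s + t = 0 -> s = - t by move/addr0_eq <-; rewrite opprK.
have [Yu2 Yv2] := (Ck_pd_u (Ys 3%N), Ck_pd_v (Ys 3%N)).
have hY z (Uz : U z) := Ck_partials (Ys 1%N) Uz.
have hYu z (Uz : U z) := Ck_partials Yu2 Uz.
have hYv z (Uz : U z) := Ck_partials Yv2 Uz.
have same_norm z : U z -> x1 (pd_u Y z) ^+ 2 + x2 (pd_u Y z) ^+ 2 + contact (Y z) (pd_u Y z) ^+ 2
   = x1 (pd_v Y z) ^+ 2 + x2 (pd_v Y z) ^+ 2 + contact (Y z) (pd_v Y z) ^+ 2.
  by move=> Uz; exact: metric_self_eq (conf z Uz).1.
have orth z : U z -> x1 (pd_u Y z) * x1 (pd_v Y z) + x2 (pd_u Y z) * x2 (pd_v Y z)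
   + contact (Y z) (pd_u Y z) * contact (Y z) (pd_v Y z) = 0.
  by move=> Uz; exact: (conf z Uz).2.
have E0 z (Uz : U z) := row_free_energy (Y z) (free z Uz).
have hp1 z (Uz : U z) := has_partials_x1 (hYu z Uz).
have hp2 z (Uz : U z) := has_partials_x2 (hYu z Uz).
have hp3 z (Uz : U z) := has_partials_eq (has_partials_contact (hY z Uz) (hYu z Uz))
  (contact_slope_self _ _) erefl.
have hq1 z (Uz : U z) := has_partials_x1 (hYv z Uz).
have hq2 z (Uz : U z) := has_partials_x2 (hYv z Uz).
have hq3 z (Uz : U z) := has_partials_eq (has_partials_contact (hY z Uz) (hYv z Uz))
  erefl (contact_slope_self _ _).
have uv z (Uz : U z) := schwarz_vec oU (Ys 2%N) Uz.
have t3 z (Uz : U z) :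
    contact_slope (pd_v Y z) (pd_u Y z) + contact (Y z) (pd_v (pd_u Y) z) =
    contact_slope (pd_u Y z) (pd_v Y z) + contact (Y z) (pd_u (pd_v Y) z)
    + (x1 (pd_u Y z) * x2 (pd_v Y z) - x2 (pd_u Y z) * x1 (pd_v Y z)).
  by rewrite (uv z Uz); exact: contact_slope_swap.
have tension z (Uz : U z) : [/\
    x1 (pd_u (pd_u Y) z) + x1 (pd_v (pd_v Y) z) +
      (x2 (pd_u Y z) * contact (Y z) (pd_u Y z) + x2 (pd_v Y z) * contact (Y z) (pd_v Y z)) = 0,
    x2 (pd_u (pd_u Y) z) + x2 (pd_v (pd_v Y) z) -
      (x1 (pd_u Y z) * contact (Y z) (pd_u Y z) + x1 (pd_v Y z) * contact (Y z) (pd_v Y z)) = 0 &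
    contact (Y z) (pd_u (pd_u Y) z) +
    contact (Y z) (pd_v (pd_v Y) z) = 0].
  apply: (tension_vanishes oU Uz (hp1 z Uz)
    (hp2 z Uz) (hp3 z Uz) (hq1 z Uz) (hq2 z Uz) (hq3 z Uz) same_norm orth (E0 z Uz)
    (congr1 (@x1 R) (uv z Uz)) (congr1 (@x2 R) (uv z Uz)) (t3 z Uz)).
  exact: (normal_tension (conf z Uz).1 (conf z Uz).2 (E0 z Uz) (H0 z Uz)).
split.
- split; [exact: Ck_x1 oU Yu2|exact: Ck_x2 oU Yu2|].
  exact: (Ck_contact oU (Ys 2%N) Yu2).
- split; [exact: Ck_x1 oU Yv2|exact: Ck_x2 oU Yv2|].
  exact: (Ck_contact oU (Ys 2%N) Yv2).
- exact: same_norm.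
- exact: orth.
- exact: E0.
- move=> z Uz; have [_ e] := has_partials_pd (hp1 z Uz).
  have [e' _] := has_partials_pd (hq1 z Uz).
  exact: etrans e (etrans (congr1 (@x1 R) (uv z Uz)) (esym e')).
- move=> z Uz; have [_ e] := has_partials_pd (hp2 z Uz).
  have [e' _] := has_partials_pd (hq2 z Uz).
  exact: etrans e (etrans (congr1 (@x2 R) (uv z Uz)) (esym e')).
- move=> z Uz; have [_ e] := has_partials_pd (hp3 z Uz).
  have [e' _] := has_partials_pd (hq3 z Uz).
  by apply: etrans e _; apply: etrans (t3 z Uz) _; congr (_ + _); exact: esym.
- move=> z Uz; have [e _] := has_partials_pd (hp1 z Uz).
  have [_ e'] := has_partials_pd (hq1 z Uz).
  have [T _ _] := tension z Uz.
  exact: etrans (congr2 +%R e e') (eq_opp _ _ T).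
- move=> z Uz; have [e _] := has_partials_pd (hp2 z Uz).
  have [_ e'] := has_partials_pd (hq2 z Uz).
  have [_ T _] := tension z Uz.
  exact: etrans (congr2 +%R e e') (subr0_eq T).
- move=> z Uz; have [e _] := has_partials_pd (hp3 z Uz).
  have [_ e'] := has_partials_pd (hq3 z Uz).
  have [_ _ T] := tension z Uz.
  exact: etrans (congr2 +%R e e') T.
Qed.

(** * The rotation exchanging g and 1/g *)

(** The change of signs is the differential of the half-turn about the E_1 axis, an
    automorphism and isometry of Nil_3. *)
Lemma minimal_frame_rotate (R : realType) (U : set R[i])
    (p1 p2 p3 q1 q2 q3 : R[i] -> R^o) : open U ->
  minimal_frame U p1 p2 p3 q1 q2 q3 ->
  minimal_frame U p1 (fun z => - p2 z) (fun z => - p3 z)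
    q1 (fun z => - q2 z) (fun z => - q3 z).
Proof.
move=> oU [[P1 P2 P3] [Q1 Q2 Q3] N O E0 t1 t2 t3 T1 T2 T3].
have pdN k (f : R[i] -> R^o) z (fk : Ck_on k.+1 U f) (Uz : U z) :=
  has_partials_pd (has_partialsN (Ck_partials fk Uz)).
split.
- by split; [exact: P1|exact: CkN oU P2|exact: CkN oU P3].
- by split; [exact: Q1|exact: CkN oU Q2|exact: CkN oU Q3].
- by move=> z Uz; rewrite !sqrrN; exact: N.
- by move=> z Uz; rewrite !mulrNN; exact: O.
- by move=> z Uz; rewrite !sqrrN; exact: E0.
- exact: t1.
- move=> z Uz; have [_ ->] := pdN _ _ _ P2 Uz; have [-> _] := pdN _ _ _ Q2 Uz.
  by rewrite (t2 z Uz).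
- move=> z Uz; have [_ ->] := pdN _ _ _ P3 Uz; have [-> _] := pdN _ _ _ Q3 Uz.
  rewrite (t3 z Uz); move: (pd_u q3 z) (p1 z) (p2 z) (q1 z) (q2 z) => *; ring.
- by move=> z Uz; rewrite !mulrNN; exact: T1.
- move=> z Uz; have [-> _] := pdN _ _ _ P2 Uz; have [_ ->] := pdN _ _ _ Q2 Uz.
  rewrite -opprD (T2 z Uz); move: (p1 z) (p3 z) (q1 z) (q3 z) => *; ring.
- move=> z Uz; have [-> _] := pdN _ _ _ P3 Uz; have [_ ->] := pdN _ _ _ Q3 Uz.
  by rewrite -opprD (T3 z Uz) oppr0.
Qed.

(** Inversion of the Riemann sphere is the half-turn about the first axis. *)
Lemma inv_stereo_ext_inv (R : realType) (w : extC R) (a b c : R) :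
  inv_stereo w = vec3 a b c -> inv_stereo (ext_inv w) = vec3 a (- b) (- c).
Proof.
have vec3_inj (a1 b1 c1 a2 b2 c2 : R) : vec3 a1 b1 c1 = vec3 a2 b2 c2 ->
    [/\ a1 = a2, b1 = b2 & c1 = c2].
  move=> e; have := congr1 (@x1 R) e; have := congr1 (@x2 R) e.
  by have := congr1 (@x3 R) e; rewrite !vec3E => -> -> ->.
case: w => [[x y]|] /=; last first.
  move=> /vec3_inj[<- <- <-]; rewrite !expr0n /= !addr0 invr1 vec3Z.
  by congr vec3; ring.
rewrite vec3Z eq_complex /= => /vec3_inj[<- <- <-].
have [/andP[/eqP -> /eqP ->]|] := boolP ((x == 0) && (y == 0)).
  by rewrite !expr0n /= !addr0 invr1; congr vec3; ring.
move=> xy0; set m := x ^+ 2 + y ^+ 2.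
have m0 : m != 0 by rewrite paddr_eq0 ?sqr_ge0// !sqrf_eq0.
have m1 : 1 + m != 0.
  by rewrite gt_eqF// ltr_wpDr// addr_ge0// sqr_ge0.
rewrite /= vec3Z -/m.
have mE : (x / m) ^+ 2 + (- (y / m)) ^+ 2 = m^-1.
  by rewrite sqrrN !expr_div_n -mulrDl -/m expr2 invfM mulVKf.
rewrite mE.
have m1' : m + 1 != 0 by rewrite addrC.
by congr vec3; field; rewrite ?m0 ?m1 ?m1'.
Qed.

Lemma inv_stereo_rotate (R : realType) (w : extC R) (p1 p2 p3 q1 q2 q3 : R) :
  inv_stereo w = (p1 ^+ 2 + p2 ^+ 2 + p3 ^+ 2)^-1 *:
    cross3 (vec3 p1 p2 p3) (vec3 q1 q2 q3) ->
  inv_stereo (ext_inv w) = (p1 ^+ 2 + (- p2) ^+ 2 + (- p3) ^+ 2)^-1 *: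
    cross3 (vec3 p1 (- p2) (- p3)) (vec3 q1 (- q2) (- q3)).
Proof.
rewrite /cross3 !vec3E !vec3Z => /inv_stereo_ext_inv ->.
by rewrite !sqrrN; congr vec3; ring.
Qed.

Theorem theorem3p6 (R : realType) (S : riemann_surface R)
    (X : S -> 'rV[R]_3) (g : S -> extC R) :
  smooth_map X -> immersion X -> conformal X -> minimal X ->
  is_gauss_map X g ->
  forall c : chart R S, atlas c ->
    (forall p : S, chart_dom c p -> g p <> None -> gauss_equation_at g c p) /\
    (forall p : S, chart_dom c p -> g p = None ->
       \forall q \near p, gauss_equation_at (fun s => ext_inv (g s)) c q).
Proof.
move=> Xs Xi Xc Xm Xg c atc.
pose U := chart_image c; pose Y := X \o chart_inv c.
have oU : open U by exact: chart_image_open.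
have fr := minimal_frame_immersion oU (Xs c atc) (Xc c atc) (Xi c atc) (Xm c atc).
have dU q : chart_dom c q -> U (chart_map c q) by move=> cq; exists q.
have normal z : U z -> inv_stereo (g (chart_inv c z)) =
    (x1 (pd_u Y z) ^+ 2 + x2 (pd_u Y z) ^+ 2 + contact (Y z) (pd_u Y z) ^+ 2)^-1 *:
    cross3 (vec3 (x1 (pd_u Y z)) (x2 (pd_u Y z)) (contact (Y z) (pd_u Y z)))
           (vec3 (x1 (pd_v Y z)) (x2 (pd_v Y z)) (contact (Y z) (pd_v Y z))).
  move=> Uz; have [same_norm orth] := Xc c atc z Uz.
  apply: etrans _ (frame_coord_unit_cross same_norm orth).
  rewrite -[X in _ = X]/(frame_coord (X (chart_inv c z)) (unit_normal Y z)).
  case: Uz => q cq <-; have Kq := chart_mapK cq.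
  apply: etrans (congr1 (fun s => inv_stereo (g s)) Kq) _.
  apply: etrans (esym (Xg c atc q cq)) _.
  by rewrite Kq.
have fr' := minimal_frame_rotate oU fr.
have normal' z (Uz : U z) := inv_stereo_rotate (normal z Uz).
split=> [p cp gp|p cp gp].
  have hp : g (chart_inv c (chart_map c p)) <> None by rewrite chart_mapK.
  have [C2 eqn] := gauss_equation_frame oU fr normal (dU p cp) hp.
  by split.
have oV := open_finite oU fr' normal'.
(* At a point where g is infinite, 1/g is finite, and it stays finite nearby. *)
have Vp : nbhs (chart_map c p) (U `&` [set z | ext_inv (g (chart_inv c z)) <> None]).
  apply: open_nbhs_nbhs; split=> //; split; first exact: dU.
  by rewrite /= chart_mapK// gp.
have near_dom : \forall q \near p, chart_dom c q.
  by apply: open_nbhs_nbhs; split=> //; exact: chart_dom_open.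
have near_V := chart_map_continuous cp Vp.
apply: filterS2 near_dom near_V => q cq [Uq hq].
have [C2 eqn] := gauss_equation_frame oU fr' normal' Uq hq.
split=> //.
by move: hq; rewrite /= chart_mapK.
Qed.
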